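(* Assume the framework described in the context (the data $X,b,B,U,C,f,g,F$ and assumptions (A1)–(A4)). Assume further that the second derivative $f''$ exists, is bounded and uniformly continuous on bounded subsets of $C\cap U$, and that $b$ is strongly convex on $C$ with a strong convexity parameter $\mu>0$. Then one can construct a sequence $(x_k)_{k=1}^\infty$, by either Algorithm A or Algorithm B (with a suitable choice of a telescopic sequence satisfying (A2)–(A4) and of the parameters of the algorithm), for which $F(x_k)$ converges to $\inf\{F(x):x\in C\}$ at a rate which can be arbitrarily close to $O(1/k)$. In particular, for all $x_{\min}\in\mathrm{MIN}(F)$, $q\in(0,1)$, $y_0\in C\cap U$ and $\alpha>\|f''(y_0)\|$, there are such a sequence $(x_k)_{k=1}^\infty$ and an index $k_0\in\mathbb{N}$ such that $$F(x_{k+1})-F(x_{\min})\le\frac{k+1}{k+1-k_0}\cdot\frac{\alpha B(x_{\min},x_{k_0})}{\mu (k+1)^{1-q}},\qquad\forall k\ge k_0.$$ Moreover, if for each $x\in C$ there exists $r_x\ge0$ such that $\{y\in U:\|y\|\ge r_x\}\neq\emptyset$ and $b$ is uniformly convex relative to $(\{x\},\{y\in U:\|y\|\ge r_x\})$ with a gauge $\psi_x$ satisfying $\lim_{t\to\infty}\psi_x(t)=\infty$ (a condition which holds, in particular, when $b$ is uniformly convex on $U$), and if $b'$ is weak-to-weak$^*$ sequentially continuous on $U$, then $(x_k)_{k=1}^\infty$ converges weakly to some point in $\mathrm{MIN}(F)$.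
   Context: **Space and Bregman function.** $(X,\|\cdot\|)$, $X\neq\{0\}$, is a real reflexive Banach space with dual $X^*$, and $\langle x^*,x\rangle:=x^*(x)$. The function $b:X\to(-\infty,\infty]$ is a semi-Bregman function with zone $U$, i.e. $U=\mathrm{Int}(\mathrm{dom}(b))\neq\emptyset$, $b$ is Gâteaux differentiable in $U$ (with gradient $b'$), $b$ is convex and lower semicontinuous on $X$ and strictly convex on $\mathrm{dom}(b)=\{x:b(x)<\infty\}$. Its Bregman divergence is $B(x,y):=b(x)-b(y)-\langle b'(y),x-y\rangle$ for $(x,y)\in\mathrm{dom}(b)\times U$ and $B(x,y):=\infty$ otherwise. $b'$ is weak-to-weak$^*$ sequentially continuous on $U$ if whenever $x_i\in U$ converge weakly to $x\in U$, $\lim_i\langle b'(x_i),w\rangle=\langle b'(x),w\rangle$ for all $w\in X$. **Convexity notions.** For nonempty $S_1',S_2'\subseteq\mathrm{dom}(b)$, $b$ is uniformly convex relative to $(S_1',S_2')$ with (relative) gauge $\psi:[0,\infty)\to[0,\infty]$ if $\psi(t)>0$ for $t>0$ and $b(\lambda x+(1-\lambda)y)+\lambda(1-\lambda)\psi(\|x-y\|)\le\lambda b(x)+(1-\lambda)b(y)$ for all $\lambda\in(0,1)$, $(x,y)\in S_1'\times S_2'$. It is uniformly convex on $S$ if it is so relative to $(S,S)$ with some gauge, and strongly convex on $S$ with parameter $\mu>0$ if it is so with the gauge $\psi(t)=\frac12\mu t^2$. **The problem.** $C\subseteq\mathrm{dom}(b)$ is nonempty, closed and convex, contains more than one point, and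 $C\cap U\ne\emptyset$. $f:\mathrm{dom}(b)\to\mathbb{R}$ is convex on $\mathrm{dom}(b)$, Gâteaux differentiable in $U$ (derivative $f'$), and its restriction to $C$ is lower semicontinuous. $g:C\to(-\infty,\infty]$ is convex, proper and lower semicontinuous. $F:X\to(-\infty,\infty]$ is $F(x):=f(x)+g(x)$ for $x\in C$ and $F(x):=\infty$ for $x\notin C$. $\mathrm{MIN}(F):=\{x\in C:F(x)=\inf_C F\}$. **Proximal operation.** For $L>0$, $\mu>0$ and a closed convex $S\subseteq C$ such that $S\cap U\neq\emptyset$, $g$ is proper on $S$, and $b$ is strongly convex on $S$ with parameter $\mu$, put, for $x\in S$ and $y\in U$, $$Q_{L,\mu,S}(x,y):=f(y)+\langle f'(y),x-y\rangle+\frac{L}{\mu}B(x,y)+g(x),$$ and for $y\in S\cap U$ let $p_{L,\mu,S}(y)$ be the minimizer of $x\mapsto Q_{L,\mu,S}(x,y)$ over $S$ (it exists and is unique). **Assumptions.** (A1) $\mathrm{MIN}(F)$ is nonempty and contained in $U$. (A2) There is a telescopic sequence $(S_k)_{k=1}^\infty$: for each $k$, $S_k$ is closed and convex, $S_k\cap U$ contains more than one point, $S_k\subseteq S_{k+1}\subseteq C$, $b$ is strongly convex on $S_k$ with parameter $\mu_k>0$, $\mu_{k+1}\le\mu_k$; moreover $\bigcup_{k}S_k=C$ and $g$ is proper on $S_1$. (A3) For each $k$, $f'$ is Lipschitz continuous on $S_k\cap U$, with smallest Lipschitz constant $L(f',S_k\cap U)$. (A4) For all $L>0$, $k\in\mathbb{N}$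 and $y\in S_k\cap U$, $p_{L,\mu_k,S_k}(y)\in S_k\cap U$. **Algorithm A (Lipschitz step size rule).** Input: $L_1>0$ with $L_1\ge L(f',S_1\cap U)$. Step 1: $x_1\in S_1\cap U$ arbitrary. Step $k\ge2$: $L_k$ is arbitrary with $L_k\ge\max\{L_{k-1},L(f',S_k\cap U)\}$, and $x_k:=p_{L_k,\mu_k,S_k}(x_{k-1})$. **Algorithm B (backtracking step size rule).** Input: $\eta>1$, and $L_1$, which is an arbitrary positive number if $S_k=C$ for all $k$, and otherwise is any number satisfying $0<L_1\le\eta L(f',S_1\cap U)$. Step 1: $x_1\in S_1\cap U$ arbitrary. Step $k\ge2$: let $i_k$ be the smallest nonnegative integer such that with $L_k:=\eta^{i_k}L_{k-1}$ one has $F(p_{L_k,\mu_k,S_k}(x_{k-1}))\le Q_{L_k,\mu_k,S_k}(p_{L_k,\mu_k,S_k}(x_{k-1}),x_{k-1})$, and set $x_k:=p_{L_k,\mu_k,S_k}(x_{k-1})$ (such $i_k$ exists). *)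

(* Defs.v *)
From HB Require Import structures.
From mathcomp Require Import all_boot all_order all_algebra.
From mathcomp Require Import all_classical all_reals all_analysis.

Set Implicit Arguments.
Unset Strict Implicit.
Unset Printing Implicit Defensive.

Import Order.TTheory GRing.Theory Num.Theory.
Import numFieldNormedType.Exports.

Local Open Scope classical_set_scope.
Local Open Scope ring_scope.

(* Sequences of the algorithms are indexed from 1: they are functions on nat
   whose value at 0 is never constrained nor used. *)

Section banach.
Context {R : realType} {X : completeNormedModType R}.
Implicit Types (l h : X -> R^o) (A D : set X).

Definition dual : set (X -> R^o) := [set l | linear l /\ continuous l].

Definition dual_norm l : R := sup [set `|l v| | v in [set v : X | `|v| <= 1]].

(* The canonical embedding of X into its bidual is onto; an element of the
   bidual is a bounded linear functional Phi on the subspace dual, the values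
   of Phi outside dual being irrelevant. *)
Definition reflexive_space : Prop :=
  forall Phi : (X -> R^o) -> R,
    (forall a l1 l2, dual l1 -> dual l2 ->
      Phi (fun x => a * l1 x + l2 x) = a * Phi l1 + Phi l2) ->
    (exists M, forall l, dual l -> `|Phi l| <= M * dual_norm l) ->
    exists x, forall l, dual l -> Phi l = l x.

Definition weak_cvg (x : nat -> X) (z : X) : Prop :=
  forall l, dual l -> l (x n) @[n --> \oo] --> l z.

Definition gradient h (y : X) : X -> R^o := fun v => 'D_v h y.

Definition gateaux_differentiable h (y : X) : Prop :=
  (forall v, derivable h y v) /\ dual (gradient h y).

(* [T v w] stands for <T v, w>, where T is the Gateaux derivative at y of the
   map z |-> gradient h z into the dual: T is a bounded linear operator from X
   to its dual and the difference quotients converge in the dual norm. *)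
Definition is_second_derivative h (y : X) (T : X -> X -> R^o) : Prop :=
  [/\ forall v, dual (T v),
      forall a u v w, T (a *: u + v) w = a * T u w + T v w,
      exists M, forall v, dual_norm (T v) <= M * `|v| &
      forall v, dual_norm (fun w =>
          t^-1 * (gradient h (y + t *: v) w - gradient h y w) - T v w)
        @[t --> (0 : R)^'] --> (0 : R)].

Definition operator_norm (T : X -> X -> R^o) : R :=
  sup [set dual_norm (T v) | v in [set v : X | `|v| <= 1]].

Definition bounded_on_bounded_subsets (T : X -> X -> X -> R^o) D : Prop :=
  forall A, A `<=` D -> bounded_set A ->
    exists M, forall y, A y -> operator_norm (T y) <= M.

Definition unif_continuous_on_bounded_subsets
    (T : X -> X -> X -> R^o) D : Prop :=
  forall A, A `<=` D -> bounded_set A ->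
    forall e, 0 < e -> exists2 d, 0 < d &
      forall y z, A y -> A z -> `|y - z| < d ->
        operator_norm (fun v w => T y v w - T z v w) < e.

Definition gradient_lipschitz h D (K : R) : Prop :=
  forall x y, D x -> D y ->
    dual_norm (fun w => gradient h x w - gradient h y w) <= K * `|x - y|.

Definition smallest_lipschitz h D : R :=
  inf [set K | 0 <= K /\ gradient_lipschitz h D K].

Definition more_than_one_point A : Prop :=
  exists x y, [/\ A x, A y & x != y].

End banach.

Section convexity.
Context {R : realType} {X : completeNormedModType R}.
Implicit Types (b h : X -> \bar R) (S : set X).
Local Open Scope ereal_scope.

Definition dom b : set X := [set x | b x < +oo].

Definition econvex_on S h : Prop :=
  forall x y (lam : R), S x -> S y -> (0 < lam < 1)%R ->
    h (lam *: x + (1 - lam) *: y)%R <= lam%:E * h x + (1 - lam)%:E * h y.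

Definition strictly_econvex_on S h : Prop :=
  forall x y (lam : R), S x -> S y -> x != y -> (0 < lam < 1)%R ->
    h (lam *: x + (1 - lam) *: y)%R < lam%:E * h x + (1 - lam)%:E * h y.

(* Lower semicontinuity of the restriction of h to S; neighborhoods of the
   points outside S are trivial in [subspace S]. *)
Definition lsc_on S h : Prop := @lower_semicontinuous (subspace S) R h.

(* psi represents a function from [0, +oo[ to [0, +oo]; its values at negative
   reals are irrelevant. *)
Definition gauge (psi : R -> \bar R) : Prop :=
  (forall t : R, (0 <= t)%R -> 0 <= psi t) /\
  (forall t : R, (0 < t)%R -> 0 < psi t).

Definition rel_uniformly_convex b S1 S2 (psi : R -> \bar R) : Prop :=
  gauge psi /\
  forall x y (lam : R), S1 x -> S2 y -> (0 < lam < 1)%R ->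
    b (lam *: x + (1 - lam) *: y)%R + (lam * (1 - lam))%:E * psi `|x - y|%R
      <= lam%:E * b x + (1 - lam)%:E * b y.

Definition uniformly_convex_on b S : Prop :=
  exists psi, rel_uniformly_convex b S S psi.

Definition strongly_convex_on b S (mu : R) : Prop :=
  (0 < mu)%R /\ rel_uniformly_convex b S S (fun t => (mu / 2 * t ^+ 2)%:E).

End convexity.

Section bregman.
Context {R : realType} {X : completeNormedModType R}.
Implicit Types (b : X -> \bar R) (C : set X).

Definition zone b : set X := (dom b)°.

Definition bgrad b (y : X) : X -> R^o := gradient (fun x => fine (b x)) y.

Definition semi_bregman b : Prop :=
  [/\ forall x, (-oo < b x)%E, zone b !=set0 &
      forall y, zone b y -> gateaux_differentiable (fun x => fine (b x)) y] /\
  [/\ econvex_on setT b, lower_semicontinuous b & strictly_econvex_on (dom b) b].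

Definition divergence b (x y : X) : \bar R :=
  if (x \in dom b) && (y \in zone b)
  then (b x - b y - (bgrad b y (x - y))%:E)%E else +oo%E.

Definition weak_to_weakstar_seq_continuous b : Prop :=
  forall (x : nat -> X) (z : X), (forall i, zone b (x i)) -> zone b z ->
    weak_cvg x z -> forall w, bgrad b (x i) w @[i --> \oo] --> bgrad b z w.

Definition growth_condition b C : Prop :=
  forall x, C x -> exists r : R, let V := zone b `&` [set y | r <= `|y|] in
    [/\ 0 <= r, V !=set0 &
        exists psi, rel_uniformly_convex b [set x] V psi /\
                    psi t @[t --> +oo] --> +oo%E].

End bregman.

Section algorithms.
Context {R : realType} {X : completeNormedModType R}.
Variables (b : X -> \bar R) (f : X -> R^o) (g : X -> \bar R) (C : set X).
Implicit Types (S : nat -> set X) (mu L : nat -> R) (x : nat -> X).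

Definition objective (z : X) : \bar R :=
  if z \in C then ((f z)%:E + g z)%E else +oo%E.

Definition optimal_value : \bar R := ereal_inf (objective @` C).

Definition minimizers : set X := [set z | C z /\ objective z = optimal_value].

Definition Q (L mu : R) (z y : X) : \bar R :=
  ((f y + gradient f y (z - y))%:E + (L / mu)%:E * divergence b z y + g z)%E.

Definition prox (L mu : R) (S : set X) (y : X) : X :=
  get [set p | S p /\ forall z, S z -> (Q L mu p y <= Q L mu z y)%E].

Definition assumption_A2 S mu : Prop :=
  (forall k, (0 < k)%N ->
    [/\ closed (S k), convex_set (S k : set (convex_lmodType X)),
        more_than_one_point (S k `&` zone b) & S k `<=` S k.+1] /\
    [/\ S k `<=` C, strongly_convex_on b (S k) (mu k) & mu k.+1 <= mu k]) /\
  \bigcup_(k in [set k | (0 < k)%N]) S k = C /\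
  exists2 z, S 1%N z & (g z < +oo)%E.

Definition assumption_A3 S : Prop :=
  forall k, (0 < k)%N ->
    exists2 K, 0 <= K & gradient_lipschitz f (S k `&` zone b) K.

Definition assumption_A4 S mu : Prop :=
  forall K k y, 0 < K -> (0 < k)%N -> (S k `&` zone b) y ->
    (S k `&` zone b) (prox K (mu k) (S k) y).

Definition lipschitz_run S mu L x : Prop :=
  [/\ 0 < L 1%N, smallest_lipschitz f (S 1%N `&` zone b) <= L 1%N,
      (S 1%N `&` zone b) (x 1%N) &
      forall k, (1 < k)%N ->
        Num.max (L k.-1) (smallest_lipschitz f (S k `&` zone b)) <= L k /\
        x k = prox (L k) (mu k) (S k) (x k.-1)].

Definition backtracking_test S mu k (K : R) (y : X) : Prop :=
  let p := prox K (mu k) (S k) y in (objective p <= Q K (mu k) p y)%E.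

Definition backtracking_run S mu (eta : R) L x : Prop :=
  [/\ 1 < eta,
      0 < L 1%N /\
      ((forall k, (0 < k)%N -> S k = C) \/
       L 1%N <= eta * smallest_lipschitz f (S 1%N `&` zone b)),
      (S 1%N `&` zone b) (x 1%N) &
      forall k, (1 < k)%N ->
        (exists i : nat,
          [/\ backtracking_test S mu k (eta ^+ i * L k.-1) (x k.-1),
              forall j, (j < i)%N ->
                ~ backtracking_test S mu k (eta ^+ j * L k.-1) (x k.-1) &
              L k = eta ^+ i * L k.-1]) /\
        x k = prox (L k) (mu k) (S k) (x k.-1)].

Inductive stepsize_rule := LipschitzRule | BacktrackingRule.

Definition run (rule : stepsize_rule) S mu x : Prop :=
  match rule with
  | LipschitzRule => exists L, lipschitz_run S mu L x
  | BacktrackingRule => exists eta L, backtracking_run S mu eta L x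
  end.

Definition constructible (rule : stepsize_rule) x : Prop :=
  exists S mu,
    [/\ assumption_A2 S mu, assumption_A3 S, assumption_A4 S mu &
        run rule S mu x].

Definition converges_at_rate (q : R) x : Prop :=
  objective (x k) @[k --> \oo] --> optimal_value /\
  exists M : R, \forall k \near \oo,
    (objective (x k) - optimal_value <= (M / k%:R `^ (1 - q))%:E)%E.

End algorithms.

(* Main.v *)
Require Import Defs.
From HB Require Import structures.
From mathcomp Require Import all_boot all_order all_algebra.
From mathcomp Require Import all_classical all_reals all_analysis.
From mathcomp Require Import ring lra.

Set Implicit Arguments.
Unset Strict Implicit.
Unset Printing Implicit Defensive.

Import Order.TTheory GRing.Theory Num.Theory.
Import numFieldNormedType.Exports.

Local Open Scope classical_set_scope.
Local Open Scope ring_scope.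

(** Both algorithms are Bregman proximal gradient methods.  At step [k] the new
iterate minimizes, over [T k], a model whose proximal weight is [L k / mu]; the
three point inequality for its minimizer, together with the descent test
[F (x k) <= Q (x k) (x k.-1)], gives for all [z] in [T k] where [g] is finite

  [F (x k) + (L k / mu) * B z (x k) <= F z + (L k / mu) * B z (x k.-1)]

(lemma [prox_sufficient_decrease]).  With [z = x k.-1] this says that [F (x k)]
is nonincreasing; with [z = xmin] it says that [B xmin (x k)] is nonincreasing
and, after telescoping from [k0], that
[(k + 1 - k0) * (F (x k.+1) - F xmin) <= (L k.+1 / mu) * B xmin (x k0)]
(lemma [objective_gap]).  The announced rate is therefore the bound
[L k <= alpha * k ^ q] for large [k].

This bound is a matter of choosing the telescope.  The proximal operation only
depends on the ratio of its two parameters, and [b] is strongly convex on the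
whole of [C] with parameter [mu], so a given telescope [S] may be traversed as
slowly as desired, with constant parameter [mu]: [T k = S (m k)], where [m] grows
to infinity so slowly that twice the Lipschitz constant of the gradient of [f] on
[T k] stays below [alpha * k ^ q] (lemmas [slow_reindexing], [telescope_exists]).
The Lipschitz rule can then take [L k = alpha * (max k k0) ^ q], while backtracking
with factor 2 never exceeds the larger of its initial value and twice the current
Lipschitz constant.  If the gradient of [f] is constant on the part of every [S j]
in the zone, the start of the backtracking rule would require [L 1 <= 0]; the
telescope is then [T k = C], and the proximal points over [C] lie in the zone
because they coincide with proximal points over some [S j].

Minimizers of the models exist because a minimizing sequence of a strongly convex
function is Cauchy.

Weak convergence is an argument of Opial type.  Strong convexity bounds the
iterates by [B xmin (x k)].  Weak cluster points are minimizers, as sublevel sets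
of [F] are convex and closed, hence weakly closed.  For two cluster points [z] and
[w], [B z (x k) - B w (x k)] converges, so the gradient of [b] takes the same value
in direction [z - w] at [z] and at [w], and [z = w] by strong convexity.  What this
needs from functional analysis is that bounded sequences of a reflexive space have
weakly convergent subsequences.  The limit along an ultrafilter is a bounded
functional on the dual, so reflexivity represents it by a point; countably many
functionals that separate a separable subspace then single out a genuine
subsequence (lemma [weakly_convergent_subsequence]).  The Hahn-Banach theorem
enters through subgradients of convex 1-Lipschitz functions: that of the norm
gives norming functionals, that of the distance to a closed convex set separates.

For the last claim, let [b] be uniformly convex on its zone.  A lower bound for the
second differences of [b] is at least multiplied by 4 when the step doubles, so
that the modulus of convexity tends to infinity with the distance. *)

(** * Hahn-Banach theorem for sublinear functionals *)

Section hahn_banach.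
Context {R : realType} {X : lmodType R}.
Implicit Types (p q l : X -> R) (x y v w : X).

(** Positive homogeneity is weakened to an inequality, which implies equality
(lemma [sublinearZ]) and is what survives the infima taken below. *)
Definition sublinear p :=
  (forall x y, p (x + y) <= p x + p y) /\
  (forall t x, 0 < t -> p (t *: x) <= t * p x).

Lemma sublinear0 p : sublinear p -> p 0 = 0.
Proof.
move=> [_ ph]; apply/eqP; rewrite eq_le.
have := ph 2 0 (ltr0Sn _ 1); have := ph 2^-1 0.
rewrite !scaler0 invr_gt0 ltr0Sn => /(_ isT) h1 h2.
by apply/andP; split; lra.
Qed.

Lemma sublinearN p x : sublinear p -> - p (- x) <= p x.
Proof. by move=> sp; have [+ _] := sp => /(_ x (- x)); rewrite subrr (sublinear0 sp); lra. Qed.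

Lemma sublinearZ p t x : sublinear p -> 0 < t -> p (t *: x) = t * p x.
Proof.
move=> [_ ph] t0; apply/eqP; rewrite eq_le ph//=.
have := ph t^-1 (t *: x); rewrite invr_gt0 => /(_ t0).
rewrite scalerA mulVf ?gt_eqF// scale1r => h.
by rewrite -(ler_pM2l (x := t^-1)) ?invr_gt0// mulrA mulVf ?gt_eqF// mul1r.
Qed.

Lemma inf_subadditive (A B C : set R) : A !=set0 -> B !=set0 ->
  has_lbound C -> (forall a b, A a -> B b -> exists2 c, C c & c <= a + b) ->
  inf C <= inf A + inf B.
Proof.
move=> A0 B0 lC h; rewrite -lerBlDr; apply: lb_le_inf => // a Aa.
rewrite lerBlDr -lerBlDl; apply: lb_le_inf => // b Bb; rewrite lerBlDl.
by have [c Cc cab] := h _ _ Aa Bb; apply: le_trans cab; exact: ge_inf.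
Qed.

Lemma inf_homogeneous (A C : set R) t : A !=set0 -> has_lbound C -> 0 < t ->
  (forall a, A a -> exists2 c, C c & c <= t * a) -> inf C <= t * inf A.
Proof.
move=> A0 lC t0 h; rewrite mulrC -ler_pdivrMr//; apply: lb_le_inf => // a Aa.
rewrite ler_pdivrMr//; have [c Cc ca] := h _ Aa.
by apply: le_trans (ge_inf lC Cc) _; rewrite mulrC.
Qed.

(** The functional [q x = inf_(t >= 0) (p (x + t v) - t p v)].  For a minimal [p]
it must coincide with [p], which makes [p] additive; its value at [- v] is at
most [- p v], which prescribes the value of linear minorants at [v]. *)
Lemma sublinear_shift p v : sublinear p -> exists q,
  [/\ sublinear q, forall x, q x <= p x &
      forall x, q x <= p (x + v) - p v].
Proof.
move=> sp; have [pa ph] := sp.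
pose E x := [set p (x + t *: v) - t * p v | t in [set t | 0 <= t]].
have lE x : lbound (E x) (- p (- x)).
  move=> _ [t /= t0 <-].
  have tv : p (t *: v) = t * p v.
    move: t0; rewrite le_eqVlt => /predU1P[<-|/(sublinearZ v sp)//].
    by rewrite scale0r mul0r (sublinear0 sp).
  by have := pa (x + t *: v) (- x); rewrite addrC addKr tv; lra.
have hE x : has_lbound (E x) by exists (- p (- x)).
have nE x : E x !=set0 by exists (p x); exists 0; rewrite //= ?scale0r ?mul0r ?subr0 ?addr0.
exists (fun x => inf (E x)); split.
- split=> [x y|t x t0].
    apply: inf_subadditive => // _ _ [s /= s0 <-] [t /= t0 <-].
    exists (p (x + y + (s + t) *: v) - (s + t) * p v);
      first by exists (s + t) => //=; rewrite addr_ge0.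
    have := pa (x + s *: v) (y + t *: v).
    by rewrite addrACA -scalerDl; lra.
  apply: inf_homogeneous => // _ [s /= s0 <-].
  exists (p (t *: x + (t * s) *: v) - (t * s) * p v);
    first by exists (t * s) => //=; rewrite mulr_ge0// ltW.
  by rewrite -scalerA -scalerDr (sublinearZ _ sp)// mulrBr mulrA.
- move=> x; apply: ge_inf => //.
  by exists 0; rewrite //= ?scale0r ?mul0r ?subr0 ?addr0.
- move=> x; apply: ge_inf => //.
  by exists 1; rewrite //= ?scale1r ?mul1r.
Qed.

(** Zorn's lemma: the infimum of a chain of sublinear functionals below [p] is
sublinear, and it is finite because each of them is at least [- p (- x)]. *)
Lemma minimal_sublinear p : sublinear p -> exists q,
  [/\ sublinear q, forall x, q x <= p x &
      forall r, sublinear r -> (forall x, r x <= q x) -> r = q].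
Proof.
move=> sp.
pose T := {q : X -> R | sublinear q /\ forall x, q x <= p x}.
pose below (q r : T) := `[< forall x, sval r x <= sval q x >].
have [| | | |[q [sq qp]] qmin] := @Zorn T below.
- by move=> q; apply/asboolP.
- move=> q r s /asboolP qr /asboolP rs; apply/asboolP => x.
  exact: le_trans (rs x) (qr x).
- move=> [q qP] [r rP] /asboolP qr /asboolP rq; apply: eq_exist.
  by apply/funext => x; apply/eqP; rewrite eq_le rq qr.
- move=> A Atot; have [[a Aa]|A0] := pselect (A !=set0); last first.
    by exists (exist _ p (conj sp (fun x => lexx (p x)))) => s As; case: A0; exists s.
  pose E x := [set sval s x | s in A].
  have hE x : has_lbound (E x).
    exists (- p (- x)) => _ [s As <-]; have [ss sps] := svalP s.
    by apply: le_trans (sublinearN _ ss); rewrite lerN2.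
  have nE x : E x !=set0 by exists (sval a x); exists a.
  have sE : sublinear (fun x => inf (E x)).
    split=> [x y|t x t0].
      apply: inf_subadditive => // _ _ [s As <-] [t At <-].
      have [/asboolP st|/asboolP ts] := Atot _ _ As At.
        have [[ta _] _] := svalP t; exists (sval t (x + y)); first by exists t.
        by apply: le_trans (ta _ _) _; rewrite lerD2r.
      have [[sa _] _] := svalP s; exists (sval s (x + y)); first by exists s.
      by apply: le_trans (sa _ _) _; rewrite lerD2l.
    apply: inf_homogeneous => // _ [s As <-].
    by have [[_ sh] _] := svalP s; exists (sval s (t *: x)); [exists s|exact: sh].
  have Ep x : inf (E x) <= p x.
    have [_ ap] := svalP a.
    by apply: le_trans (ap x); apply: ge_inf => //; exists a.
  exists (exist _ (fun x => inf (E x)) (conj sE Ep)) => s As; apply/asboolP => x /=.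
  by apply: ge_inf => //; exists s.
exists q; split=> // r sr rq.
have rp x : r x <= p x by exact: le_trans (rq x) (qp x).
have /= := qmin (exist _ r (conj sr rp)).
by move=> /(_ (asboolT rq)) [].
Qed.

(** A minimal sublinear functional is linear.  Minimality is applied below the
shift of [p] by [w] instead of below [p], to reach the value [p w] at [w]. *)
Lemma hahn_banach_sublinear p w : sublinear p ->
  exists l : X -> R^o, [/\ linear l, forall x, l x <= p x & l w = p w].
Proof.
move=> sp; have [pw [spw pwp pww]] := sublinear_shift w sp.
have [l [sl lp lmin]] := minimal_sublinear spw.
have la x v : l (x + v) = l x + l v.
  have [q [sq ql qv]] := sublinear_shift v sl.
  have := qv x; rewrite (lmin q)// => h.
  by apply/eqP; rewrite eq_le; have [-> _] := sl; move: h; lra.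
have lN x : l (- x) = - l x.
  by apply/eqP; rewrite -subr_eq0 opprK -la addNr (sublinear0 sl).
have lZ (t : R) x : l (t *: x) = t * l x.
  have [t0|t0|<-] := ltgtP 0 t; last by rewrite scale0r mul0r (sublinear0 sl).
    exact: sublinearZ.
  rewrite -[t]opprK scaleNr lN sublinearZ ?oppr_gt0//; lra.
exists l; split.
- by move=> t x y; rewrite la lZ.
- by move=> x; exact: le_trans (lp x) (pwp x).
- apply/eqP; rewrite eq_le (le_trans (lp w) (pwp w))/=.
  have := le_trans (lp (- w)) (pww (- w)).
  by rewrite lN addNr (sublinear0 sp); lra.
Qed.

End hahn_banach.

(** * Continuous linear functionals and weakly closed convex sets *)

Section functionals.
Context {R : realType} {X : completeNormedModType R}.
Implicit Types (l : X -> R^o) (A : set X) (d : X -> R).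

Lemma dual_bounded l : linear l -> (exists M, forall v, `|l v| <= M * `|v|) -> dual l.
Proof.
move=> ll [M lM]; split=> //.
pose L : {linear X -> R^o} := HB.pack l (GRing.isLinear.Build _ _ _ _ l ll).
apply: (@bounded_linear_continuous _ _ _ L); apply/linear_boundedP.
near=> r => x; apply: le_trans (lM x) _.
by apply: ler_wpM2r => //; near: r; exact: nbhs_pinfty_ge.
Unshelve. all: by end_near. Qed.

Lemma dual_bound l : dual l -> exists2 M, 0 < M & forall v, `|l v| <= M * `|v|.
Proof.
move=> [ll lc].
pose L : {linear X -> R^o} := HB.pack l (GRing.isLinear.Build _ _ _ _ l ll).
have /linear_boundedP : bounded_near L (nbhs 0) by apply/linear_bounded_continuous.
move=> h; have [M [M0 lM]] : exists M, 0 < M /\ forall x, `|L x| <= M * `|x|.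
  near (+oo : set_system R) => M; exists M; split.
    by near: M; exact: nbhs_pinfty_gt.
  by near: M; exact: h.
by exists M.
Unshelve. all: by end_near. Qed.

Section dual_theory.
Variable l : X -> R^o.
Hypothesis ll : dual l.

Lemma dualD u v : l (u + v) = (l u : R) + l v :> R.
Proof. by have [+ _] := ll => /(_ 1 u v); rewrite !scale1r. Qed.

Lemma dual0 : l 0 = 0 :> R.
Proof. by have := dualD 0 0; rewrite addr0 => h; apply: (addrI (l 0)); rewrite addr0. Qed.

Lemma dualZ t v : l (t *: v) = t * (l v : R) :> R.
Proof. by have [+ _] := ll => /(_ t v 0); rewrite !addr0 dual0 addr0. Qed.

Lemma dualN v : l (- v) = - (l v : R) :> R.
Proof. by rewrite -scaleN1r dualZ mulN1r. Qed.

Lemma dualB u v : l (u - v) = (l u : R) - l v :> R.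
Proof. by rewrite dualD dualN. Qed.

Let values := [set `|l v| | v in [set v : X | `|v| <= 1]].

Let has_sup_values : has_sup values.
Proof.
split; first by exists `|l 0|; exists 0; rewrite //= normr0.
have [M M0 lM] := dual_bound ll; exists M => _ [v /= v1 <-].
by apply: le_trans (lM v) _; rewrite ger_pMr.
Qed.

Lemma dual_norm_ge0 : 0 <= dual_norm l.
Proof.
apply: le_trans (normr_ge0 (l 0)) _; apply: sup_upper_bound => //.
by exists 0; rewrite //= normr0.
Qed.

Lemma dual_normP v : `|l v| <= dual_norm l * `|v|.
Proof.
have [->|v0] := eqVneq v 0; first by rewrite dual0 !normr0 mulr0.
have nv : 0 < `|v| by rewrite normr_gt0.
rewrite -ler_pdivrMr//.
have -> : `|l v| / `|v| = `|l (`|v|^-1 *: v)|.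
  by rewrite dualZ normrM normfV normr_id mulrC.
apply: sup_upper_bound => //; exists (`|v|^-1 *: v) => //=.
by rewrite normrZ normfV normr_id mulVf ?gt_eqF.
Qed.

End dual_theory.

Lemma dual_sub l1 l2 : dual l1 -> dual l2 -> dual (fun v => l1 v - l2 v).
Proof.
move=> d1 d2; apply: dual_bounded.
  move=> a u v; rewrite !dualD// !dualZ//=.
  by rewrite (_ : forall t x : R, t *: (x : R^o) = t * x)//; ring.
have [M1 _ h1] := dual_bound d1; have [M2 _ h2] := dual_bound d2.
exists (M1 + M2) => v; rewrite mulrDl.
by apply: le_trans (ler_normB _ _) _; exact: lerD.
Qed.

(** The one-sided directional derivative [inf_(t > 0) (d (x0 + t v) - d x0) / t] is
sublinear by convexity, and between [- `|v|] and [`|v|] by the Lipschitz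
property; its linear minorants are subgradients. *)
Lemma subgradient_exists d (x0 : X) :
  (forall x y t, 0 < t < 1 ->
    d (t *: x + (1 - t) *: y) <= t * d x + (1 - t) * d y) ->
  (forall x y, `|d x - d y| <= `|x - y|) ->
  exists l, [/\ dual l, forall v, `|l v| <= `|v| &
                forall v, d x0 + l (v - x0) <= d v].
Proof.
move=> dconv dlip.
pose E v := [set (d (x0 + t *: v) - d x0) / t | t in [set t | 0 < t]].
have lE v : lbound (E v) (- `|v|).
  move=> _ [t /= t0 <-]; rewrite ler_pdivlMr// mulNr.
  have := dlip (x0 + t *: v) x0.
  rewrite addrAC subrr add0r normrZ gtr0_norm// => /ler_normlP[]; lra.
have hE v : has_lbound (E v) by exists (- `|v|).
have nE v : E v !=set0 by exists ((d (x0 + 1 *: v) - d x0) / 1); exists 1 => /=.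
have sp : sublinear (fun v => inf (E v)).
  split=> [u v|a v a0].
    apply: inf_subadditive => // _ _ [s /= s0 <-] [t /= t0 <-].
    have st0 : 0 < s + t by rewrite addr_gt0.
    (* the step for which [x0 + r (u + v)] lies between [x0 + s u] and [x0 + t v] *)
    pose r := s * t / (s + t).
    have r0 : 0 < r by rewrite !(mulr_gt0, invr_gt0).
    exists ((d (x0 + r *: (u + v)) - d x0) / r); first by exists r.
    have tst : 0 < t / (s + t) < 1 by rewrite divr_gt0//= ltr_pdivrMr// mul1r ltrDr.
    have := dconv (x0 + s *: u) (x0 + t *: v) (t / (s + t)) tst.
    have -> : t / (s + t) *: (x0 + s *: u) + (1 - t / (s + t)) *: (x0 + t *: v) =
              x0 + r *: (u + v).
      rewrite !scalerDr !scalerA addrACA -scalerDl addrC.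
      have -> : t / (s + t) + (1 - t / (s + t)) = 1 by ring.
      rewrite scale1r addrC; congr (_ + (_ *: _ + _ *: _)); rewrite /r; field; exact: lt0r_neq0.
    rewrite ler_pdivrMr// => h.
    have -> : ((d (x0 + s *: u) - d x0) / s + (d (x0 + t *: v) - d x0) / t) * r =
       t / (s + t) * d (x0 + s *: u) + (1 - t / (s + t)) * d (x0 + t *: v) - d x0.
      by rewrite /r; field; rewrite !lt0r_neq0.
    by rewrite lerB.
  apply: inf_homogeneous => // _ [s /= s0 <-].
  exists ((d (x0 + (s / a) *: (a *: v)) - d x0) / (s / a)).
    by exists (s / a); rewrite //= divr_gt0.
  rewrite scalerA divfK ?gt_eqF// le_eqVlt; apply/orP; left; apply/eqP; field.
  by rewrite !lt0r_neq0.
have [l [ll lp _]] := hahn_banach_sublinear 0 sp.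
have lE1 v : l v <= d (x0 + v) - d x0.
  apply: le_trans (lp v) _; apply: ge_inf => //; exists 1 => //=.
  by rewrite scale1r divr1.
have l1 v : `|l v| <= `|v|.
  have lv w : l w <= `|w|.
    apply: le_trans (lE1 w) _; have := dlip (x0 + w) x0.
    by rewrite addrAC subrr add0r => /ler_normlP[]; lra.
  rewrite ler_norml lv andbT lerNl.
  pose L : {linear X -> R^o} := HB.pack l (GRing.isLinear.Build _ _ _ _ l ll).
  have -> : - l v = l (- v) by rewrite -[l]/(L : X -> R^o) raddfN.
  by rewrite -(normrN v).
exists l; split => //.
  by apply: dual_bounded => //; exists 1 => v; rewrite mul1r.
by move=> v; have := lE1 (v - x0); rewrite [x0 + _]addrC subrK; lra.
Qed.

Lemma norming_functional (x0 : X) :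
  exists l, [/\ dual l, forall v, `|l v| <= `|v| & l x0 = `|x0|].
Proof.
have [|x y|l [ld l1 lx]] := @subgradient_exists (fun x => `|x|) x0.
- move=> x y t /andP[t0 t1]; apply: le_trans (ler_normD _ _) _.
  by rewrite !normrZ gtr0_norm// gtr0_norm// subr_gt0.
- exact: ler_dist_dist.
exists l; split => //; apply/eqP; rewrite eq_le (le_trans (ler_norm _) (l1 _))/=.
by have := lx 0; rewrite sub0r dualN// normr0; lra.
Qed.

Lemma closure_normP A x :
  closure A x <-> forall e, 0 < e -> exists2 a, A a & `|x - a| < e.
Proof.
split=> [Ax e e0|h B /nbhs_normP[e /= e0 eB]].
  have [a [Aa]] := Ax (ball x e) (nbhsx_ballx x e e0).
  by rewrite -ball_normE /= => xa; exists a.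
have [a Aa xa] := h _ e0; exists a; split => //; exact: eB.
Qed.

Section distance.
Variable A : set X.
Hypothesis A0 : A !=set0.
Hypothesis A_convex : forall x y t, A x -> A y -> 0 < t < 1 -> A (t *: x + (1 - t) *: y).

Let E x := [set `|x - a| | a in A].
Let dist x := inf (E x).

Let lE x : has_lbound (E x). Proof. by exists 0 => _ [a _ <-]. Qed.
Let nE x : E x !=set0. Proof. by have [a Aa] := A0; exists `|x - a|; exists a. Qed.

Let dist_lip x y : `|dist x - dist y| <= `|x - y|.
Proof.
have h u v : dist u - dist v <= `|u - v|.
  rewrite lerBlDr -lerBlDl; apply: lb_le_inf => // _ [a Aa <-].
  rewrite lerBlDl.
  apply: le_trans (_ : `|u - a| <= _); first by apply: ge_inf => //; exists a.
  by rewrite -[u - a](subrKA v) ler_normD.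
by rewrite ler_norml h andbT; have := h y x; rewrite distrC; lra.
Qed.

Let dist_convex x y t : 0 < t < 1 ->
  dist (t *: x + (1 - t) *: y) <= t * dist x + (1 - t) * dist y.
Proof.
move=> /[dup] t01 /andP[t0 t1]; apply/ler_addgt0Pr => e e0.
have [_ [a Aa <-] xa] := inf_adherent e0 (conj (nE x) (lE x)).
have [_ [a' Aa' <-] xa'] := inf_adherent e0 (conj (nE y) (lE y)).
apply: (@le_trans _ _ `|t *: x + (1 - t) *: y - (t *: a + (1 - t) *: a')|).
  by apply: ge_inf => //; exists (t *: a + (1 - t) *: a') => //; exact: A_convex.
have -> : t *: x + (1 - t) *: y - (t *: a + (1 - t) *: a') =
          t *: (x - a) + (1 - t) *: (y - a').
  by rewrite !scalerBr opprD addrACA.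
apply: le_trans (ler_normD _ _) _; rewrite !normrZ !gtr0_norm ?subr_gt0//.
apply: le_trans (_ : t * (dist x + e) + (1 - t) * (dist y + e) <= _); last by lra.
by apply: lerD; rewrite ler_wpM2l ?ltW// subr_gt0.
Qed.

(** A subgradient [l] at [z] of the distance to [A] satisfies
[l a <= l z - dist z] on [A]; in the limit [dist z <= 0]. *)
Lemma weak_limit_in_convex_closed (I : Type) (F : set_system I) (x : I -> X) z :
  ProperFilter F -> closed A -> (\forall n \near F, A (x n)) ->
  (forall l, dual l -> l (x n) @[n --> F] --> l z) -> A z.
Proof.
move=> FF Ac Fx lx; apply: Ac; apply/closure_normP => e e0.
suff : dist z <= 0.
  have [_ [a Aa <-] za dz] := inf_adherent e0 (conj (nE z) (lE z)).
  by exists a => //; apply: lt_le_trans za _; rewrite gerDr.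
have [l [dl _ ld]] := subgradient_exists z dist_convex dist_lip.
suff : l z <= l z - dist z by rewrite lerBrDr gerDl.
have dA a : A a -> dist a <= 0.
  by move=> Aa; apply: ge_inf => //; exists a; rewrite //= subrr normr0.
apply: (cvgr_to_le (lx _ dl)); apply: filterS Fx => n Axn.
by have := dA _ Axn; have := ld (x n); rewrite dualB//; lra.
Qed.

End distance.
End functionals.

Lemma not_cvg_far {R : realType} (u : nat -> R) (a : R) : ~ (u n @[n --> \oo] --> a) ->
  exists2 eps, 0 < eps & forall N, exists k, (N <= k)%N /\ eps <= `|a - u k|.
Proof.
move=> ncv; apply: contrapT => nfar; apply: ncv; apply/cvgrPdist_lt => eps eps0.
apply: contrapT => nnear; apply: nfar; exists eps => // N.
apply: contrapT => nk; apply: nnear; exists N => // k /= Nk.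
by rewrite ltNge; apply/negP => ek; apply: nk; exists k.
Qed.

(** * Weak sequential compactness in reflexive spaces *)

Section weak_compactness.
Context {R : realType} {X : completeNormedModType R}.
Implicit Types (l : X -> R^o) (A : set X) (x : nat -> X).

Lemma ultra_real_limit (I : Type) (U : set_system I) (u : I -> R) (M : R) :
  UltraFilter U -> (forall n, `|u n| <= M) -> exists c : R, u n @[n --> U] --> c.
Proof.
move=> UU uM.
have [|c [_ cU]] := @segment_compact R (- M) M (u n @[n --> U]) _.
  by apply: (@filterE _ U) => n; rewrite /= in_itv/= -ler_norml.
exists c => N cN.
have [//|UN] := in_ultra_setVsetC (u @^-1` N) UU.
by have [y []] := cU (~` N) N UN cN.
Qed.

(** The limit along [U] of [l (x n)], as a function of [l], is a bounded linear
functional on the dual, hence the evaluation at a point. *)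
Lemma ultra_weak_limit (I : Type) (U : set_system I) (x : I -> X) (M : R) :
  reflexive_space (X := X) -> UltraFilter U -> (forall n, `|x n| <= M) ->
  exists z, forall l, dual l -> l (x n) @[n --> U] --> l z.
Proof.
move=> refl UU xM.
have M0 : 0 <= M.
  have [n _] := @filter_ex _ U _ setT filterT.
  exact: le_trans (normr_ge0 _) (xM n).
have lx l : dual l -> forall n, `|l (x n)| <= M * dual_norm l.
  move=> dl n; apply: le_trans (dual_normP dl _) _.
  by rewrite mulrC ler_wpM2r// dual_norm_ge0.
have cvl l : dual l -> cvg (l (x n) @[n --> U]).
  by move=> dl; have [c cl] := ultra_real_limit UU (lx l dl); apply/cvg_ex; exists c.
have [||z Pz] := refl (fun l => lim (l (x n) @[n --> U])).
- move=> a l1 l2 d1 d2.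
  apply: cvg_lim => //; apply: cvgD; last exact: cvl.
  by apply: cvgM; [exact: cvg_cst|exact: cvl].
- exists M => l dl; apply: (@cvgr_to_le _ U _ _ (fun n => `|l (x n)|)).
    by apply: cvg_norm; exact: cvl.
  by apply: filterE => n; exact: lx.
by exists z => l dl; rewrite -(Pz _ dl); exact: cvl.
Qed.

(** The rational combinations of [w] are enumerated by the countable type
[{poly rat}], whose coefficients serve as coefficients of the combination. *)
Section rational_span.
Variable w : nat -> X.

Let comb (s : {poly rat}) : X := \sum_(i < size s) ratr s`_i *: w i.

Let combE (s : {poly rat}) n : (size s <= n)%N -> comb s = \sum_(i < n) ratr s`_i *: w i.
Proof.
move=> sn; rewrite /comb (big_ord_widen _ (fun i => ratr s`_i *: w i) sn).
rewrite [RHS](bigID (fun i : 'I_n => (i < size s)%N))/= [X in _ = _ + X]big1 ?addr0//.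
by move=> i; rewrite -leqNgt => ?; rewrite nth_default// rmorph0 scale0r.
Qed.

Let combP (p q : rat) (s t : {poly rat}) :
  ratr p *: comb s + ratr q *: comb t = comb (p *: s + q *: t).
Proof.
pose n := maxn (size s) (size t).
rewrite (@combE s n) ?leq_maxl// (@combE t n) ?leq_maxr// (@combE _ n).
  rewrite !scaler_sumr -big_split/=; apply: eq_bigr => i _.
  by rewrite coefD !coefZ rmorphD !rmorphM scalerDl !scalerA.
apply: leq_trans (size_polyD _ _) _; rewrite geq_max.
by rewrite !(leq_trans (size_scale_leq _ _)) ?leq_maxl ?leq_maxr.
Qed.

Let combXn n : comb 'X^n = w n.
Proof.
rewrite (@combE _ n.+1) ?size_polyXn// big_ord_recr/= big1 ?add0r.
  by rewrite coefXn eqxx rmorph1 scale1r.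
by move=> i _; rewrite coefXn (ltn_eqF (ltn_ord i)) rmorph0 scale0r.
Qed.

Lemma separable_convex_set : exists e : nat -> X,
  (forall n, range e (w n)) /\
  forall (x y : X) t, closure (range e) x -> closure (range e) y -> 0 < t < 1 ->
    closure (range e) (t *: x + (1 - t) *: y).
Proof.
pose e n := if unpickle n is Some s then comb s else 0.
have ec (s : {poly rat}) : e (pickle s) = comb s by rewrite /e pickleK.
have e0 : e (pickle (0 : {poly rat})) = 0.
  by rewrite ec /comb size_poly0 big_ord0.
have re (x : X) : range e x -> exists s, x = comb s.
  move=> [n _ <-]; rewrite /e; case: unpickle => [s|]; first by exists s.
  by exists 0; rewrite -e0 ec.
exists e; split; first by move=> n; exists (pickle ('X^n : {poly rat})); rewrite // ec combXn.
move=> x y t /closure_normP cx /closure_normP cy /andP[t0 t1].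
apply/closure_normP => eps eps0.
have eps2 : 0 < eps / 2 by rewrite divr_gt0.
have [a /re[s ->] xa] := cx _ eps2; have [b /re[r ->] yb] := cy _ eps2.
set a' := comb s in xa *; set b' := comb r in yb *.
(* adding 1 keeps the denominator positive when [a' = b'] *)
pose K := `|a' - b'| + 1.
have K0 : 0 < K by rewrite ltr_wpDl.
have [|p] := @rat_in_itvoo R (t - eps / (2 * K)) (t + eps / (2 * K)).
  by rewrite ltrBlDr -addrA ltrDl addr_gt0// divr_gt0// mulr_gt0.
rewrite in_itv/= => /andP[p1 p2].
have tp : `|t - ratr p| < eps / (2 * K) by rewrite ltr_norml; lra.
exists (ratr p *: a' + ratr (1 - p) *: b').
  by rewrite combP; exists (pickle (p *: s + (1 - p) *: r)).
have -> : t *: x + (1 - t) *: y - (ratr p *: a' + ratr (1 - p) *: b') =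
   t *: (x - a') + (1 - t) *: (y - b') + (t - ratr p) *: (a' - b').
  have pa : ratr p *: a' = t *: a' - (t - ratr p) *: a' by rewrite -scalerBl subKr.
  have pb : ratr (1 - p) *: b' = (1 - t) *: b' + (t - ratr p) *: b'.
    by rewrite -scalerDl rmorphB rmorph1; congr (_ *: _); ring.
  rewrite pa pb !scalerBr !opprD !opprK !addrA.
  by rewrite [LHS](ACl (1*3*2*5*4*6)).
have -> : eps = eps / 2 + eps / 2 by rewrite -splitr.
apply: le_lt_trans (ler_normD _ _) _; apply: ler_ltD.
  apply: le_trans (ler_normD _ _) _; rewrite !normrZ !gtr0_norm ?subr_gt0//.
  apply: le_trans (_ : t * (eps / 2) + (1 - t) * (eps / 2) <= _); last by lra.
  by apply: lerD; rewrite ler_wpM2l ?ltW// subr_gt0.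
rewrite normrZ.
apply: le_lt_trans (_ : `|t - ratr p| * K < _).
  by rewrite ler_wpM2l// lerDl.
rewrite (_ : eps / 2 = eps / (2 * K) * K); first by rewrite ltr_pM2r.
by field; exact: lt0r_neq0.
Qed.

End rational_span.

(** The functionals norm the points [e i]: if [y] is close to [e i] and [lam i]
vanishes at [y], then [`|e i|] is small. *)
Lemma separable_separating_functionals (e : nat -> X) :
  exists lam : nat -> X -> R^o, (forall i, dual (lam i)) /\
    forall y, closure (range e) y -> (forall i, lam i y = 0) -> y = 0.
Proof.
have [lam lamP] := choice (fun i => norming_functional (e i)).
exists lam; split; first by move=> i; have [] := lamP i.
move=> y /closure_normP cy ly; apply/eqP; rewrite -normr_le0.
apply/ler_addgt0Pr => eps eps0; rewrite add0r.
have [_ [i _ <-] yi] := cy (eps / 2) (divr_gt0 eps0 (ltr0Sn _ 1)).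
have [dl l1 le] := lamP i.
have h1 : `|e i| <= `|y - e i|.
  rewrite -le -[lam i _]opprK -[- lam i _]add0r -(ly i) -dualB// -dualN//.
  by rewrite (le_trans (ler_norm _))// (le_trans (l1 _))// normrN.
rewrite -(subrK (e i) y); apply: le_trans (ler_normD _ _) _; lra.
Qed.

(** Let [z] be the weak limit along an ultrafilter [U].  Infinitely many [x n] are
close to [z] for any finite number of functionals, so some subsequence
converges to [z] for countably many functionals separating the closed rational
span of the [x n - z].  Any weak limit of a further subsequence along [U] differs
from [z] by an element of that span on which these functionals vanish, so it is
[z]. *)
Lemma weakly_convergent_subsequence (x : nat -> X) (M : R) :
  reflexive_space (X := X) -> (forall n, `|x n| <= M) ->
  exists phi z, (forall k, (k <= phi k)%N) /\ weak_cvg (x \o phi) z.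
Proof.
move=> refl xM.
(* [U] contains the sets of all large indices *)
have [U [UU leU]] := ultraFilterLemma (eventually_filter).
have [z zP] := ultra_weak_limit refl UU xM.
have [e [we ce]] := separable_convex_set (fun n => x n - z).
have [lam [dlam lam0]] := separable_separating_functionals e.
have near_z k : exists n, (k <= n)%N /\
    forall i, (i <= k)%N -> `|lam i z - lam i (x n)| < k.+1%:R^-1.
  suff : \forall n \near U, (k <= n)%N /\
      forall i, (i <= k)%N -> `|lam i z - lam i (x n)| < k.+1%:R^-1.
    exact: filter_ex.
  apply: filterI; first by apply: leU; exact: nbhs_infty_ge.
  have h : \forall n \near U, forall i : 'I_k.+1, `|lam i z - lam i (x n)| < k.+1%:R^-1.
    apply: (@filter_forall nat 'I_k.+1 (fun i n => `|lam i z - lam i (x n)| < k.+1%:R^-1)) => i.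
    by have /cvgrPdist_lt := zP _ (dlam i); apply.
  by apply: filterS h => n hn i ik; exact: (hn (Ordinal (ik : (i < k.+1)%N))).
have [phi phiP] := choice near_z.
exists phi, z; split; first by move=> k; have [] := phiP k.
have lamphi i : lam i (x (phi k)) @[k --> \oo] --> lam i z.
  apply/cvgrPdist_lt => eps eps0; near=> k.
  have [_ /(_ i) h] := phiP k; apply: lt_le_trans (h _) _.
    by near: k; exact: nbhs_infty_ge.
  rewrite invf_ple ?posrE//; near: k.
  exists (Num.truncn eps^-1).+1 => // k /= tk.
  by apply: le_trans (ltW (truncnS_gt _)) _; rewrite ler_nat ltnW// ltnS ltnW.
move=> l dl; apply: contrapT => ncv.
have [eps eps0 far] := not_cvg_far ncv.
have [psi psiP] := choice far.
have xpsiM k : `|x (phi (psi k))| <= M by [].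
have [z' z'P] := ultra_weak_limit refl UU xpsiM.
have psioo : psi k @[k --> \oo] --> \oo.
  move=> A [N _ NA]; exists N => // k /= Nk; apply: NA => /=.
  by have [+ _] := psiP k; exact: leq_trans.
have zz' : z' = z.
  apply/eqP; rewrite -subr_eq0; apply/eqP; apply: lam0.
    apply: (@weak_limit_in_convex_closed _ _ _ _ _ _ U (fun k => x (phi (psi k)) - z)) => //.
    - by exists (x 0%N - z); apply: subset_closure.
    - exact: closed_closure.
    - by apply: filterE => k; exact/subset_closure/we.
    - move=> l' dl'; rewrite dualB//.
      under eq_cvg do rewrite dualB//.
      by apply: cvgB; [exact: z'P|exact: cvg_cst].
  move=> i; rewrite dualB//; apply/eqP; rewrite subr_eq0; apply/eqP.
  have h1 := z'P _ (dlam i).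
  have h2 : lam i (x (phi (psi k))) @[k --> U] --> lam i z.
    by apply: cvg_trans (cvg_comp _ _ psioo (lamphi i)); apply: cvg_app.
  by rewrite -(cvg_lim _ h1) ?(cvg_lim _ h2)//.
have := z'P _ dl; rewrite zz' => /cvgrPdist_lt/(_ _ eps0) h.
have [k] := @filter_ex _ U _ _ h.
by have [_] := psiP k; rewrite ltNge => ->.
Unshelve. all: by end_near. Qed.

End weak_compactness.

(** * Minimization of strongly convex functions *)

Section strongly_convex_minimization.
Context {R : realType} {X : completeNormedModType R}.
Variables (A : set X) (h : X -> R) (m : R).
Hypothesis m0 : 0 < m.
Hypothesis A0 : A !=set0.
Hypothesis A_convex : forall x y t, A x -> A y -> 0 < t < 1 -> A (t *: x + (1 - t) *: y).
Hypothesis h_convex : forall x y t, A x -> A y -> 0 < t < 1 ->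
  h (t *: x + (1 - t) *: y) + t * (1 - t) * (m / 2 * `|x - y| ^+ 2) <=
  t * h x + (1 - t) * h y.
Hypothesis h_closed : forall a, closed [set x | A x /\ h x <= a].

(** Lower semicontinuity bounds [h] below near a point [z0].  Away from [z0], strong
convexity along the segment to [z0] makes [h] grow at least like
[m / 4 * D ^ 2 - (2 / r) * D] in the distance [D], which is bounded below. *)
Lemma strongly_convex_bounded_below : has_lbound (h @` A).
Proof.
have [z0 Az0] := A0.
have [r r0 hr] : exists2 r, 0 < r & forall x, A x -> `|x - z0| < r -> h z0 - 1 < h x.
  have : ~ closure [set x | A x /\ h x <= h z0 - 1] z0.
    by move=> /h_closed[_]; lra.
  rewrite closure_normP => /existsNP[e /not_implyP[e0 he]].
  exists e => // x Ax xz; rewrite ltNge; apply/negP => hx.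
  by apply: he; exists x => //; rewrite distrC.
have r2m : 0 < r ^+ 2 * m by rewrite mulr_gt0// exprn_gt0.
exists (h z0 - 1 - 4 / (r ^+ 2 * m)) => _ [x Ax <-].
have [xr|rx] := ltP `|x - z0| r.
  have := hr _ Ax xr; have := @divr_ge0 R 4 (r ^+ 2 * m) (ler0n _ 4) (ltW r2m); lra.
set D := `|x - z0| in rx.
have D0 : 0 < D by exact: lt_le_trans rx.
(* puts the point at distance [r / 2] from [z0], where [h] is bounded below *)
pose t := (r / 2) / D.
have t0 : 0 < t by rewrite !divr_gt0.
have t1 : t <= 2^-1 by rewrite ler_pdivrMr// mulrC ler_wpM2l.
have tD : t * D = r / 2 by rewrite divfK// gt_eqF.
have t01 : 0 < t < 1 by rewrite t0/=; lra.
have wz : `|t *: x + (1 - t) *: z0 - z0| < r.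
  rewrite scalerBl scale1r addrAC addrA subrK -scalerBr normrZ gtr0_norm// -/D tD; lra.
have := hr _ (A_convex Ax Az0 t01) wz.
have := h_convex Ax Az0 t01; rewrite -/D.
set W := h _ => hW hW'.
(* the reciprocal of [t] is [c * D] *)
pose c := 2 / r.
have tcD : t * (c * D) = 1 by rewrite mulrCA tD /c; field; exact: lt0r_neq0.
have tD2 : 0 <= t * (2^-1 - t) * (m / 2 * D ^+ 2).
  apply: mulr_ge0; first by rewrite mulr_ge0 ?subr_ge0// ltW.
  by rewrite mulr_ge0 ?sqr_ge0// divr_ge0// ltW.
have : 0 < t * (h x - h z0 + c * D - m / 4 * D ^+ 2).
  rewrite mulrBr mulrDr tcD; move: hW hW' tD2.
  have -> : t * (m / 4 * D ^+ 2) = t / 2 * (m / 2 * D ^+ 2) by field.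
  rewrite !mulrBr !mulrBl; lra.
rewrite pmulr_rgt0//.
have : 0 <= m / 4 * (D - 2 * c / m) ^+ 2 by rewrite mulr_ge0 ?sqr_ge0// divr_ge0// ltW.
have -> : m / 4 * (D - 2 * c / m) ^+ 2 = m / 4 * D ^+ 2 - c * D + 4 / (r ^+ 2 * m).
  by rewrite /c; field; rewrite !lt0r_neq0.
lra.
Qed.

(** Strong convexity at midpoints makes minimizing sequences Cauchy. *)
Lemma strongly_convex_minimizer_exists : exists p, A p /\ forall z, A z -> h p <= h z.
Proof.
have hA : has_inf (h @` A).
  split; last exact: strongly_convex_bounded_below.
  by have [z Az] := A0; exists (h z); exists z.
set v := inf (h @` A) in hA *.
have vle z : A z -> v <= h z by move=> Az; apply: ge_inf; [exact: hA.2|exists z].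
have step n : exists z, A z /\ h z < v + n.+1%:R^-1.
  have [|_ [z Az <-] hz] := inf_adherent (_ : 0 < n.+1%:R^-1) hA.
    by rewrite invr_gt0.
  by exists z.
have [p pP] := choice step.
have dist n k : (n <= k)%N -> `|p n - p k| ^+ 2 <= 8 / m * n.+1%:R^-1.
  move=> nk; have [An hn] := pP n; have [Ak hk] := pP k.
  have half : 0 < (2^-1 : R) < 1 by rewrite invr_gt0 ltr0Sn invf_lt1// ltr1n.
  have := h_convex An Ak half; have := vle _ (A_convex An Ak half).
  set W := h _ => h1 h2.
  have kn : (k.+1%:R^-1 : R) <= n.+1%:R^-1 by rewrite lef_pV2 ?posrE// ler_nat.
  rewrite mulrAC ler_pdivlMr// .
  move: h1 h2 hn hk kn; set a := n.+1%:R^-1; set b := k.+1%:R^-1; set c := _ ^+ 2.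
  have -> : 2^-1 * (1 - 2^-1) * (m / 2 * c) = c * m / 8 by field.
  lra.
have cvp : cvg (p n @[n --> \oo]).
  apply: cauchy_cvg; apply: cauchy_exP => e e0.
  near \oo => N; exists (p N).
  exists N => // k /= Nk; rewrite -ball_normE /=.
  rewrite -(ltr_pXn2r (ltn0Sn 1)) ?nnegrE ?(ltW e0)//.
  apply: le_lt_trans (dist _ _ Nk) _.
  rewrite ltr_pdivrMr ?ltr0n// [_ * N.+1%:R]mulrC -ltr_pdivrMr ?exprn_gt0//.
  near: N; exists (Num.truncn (8 / m / e ^+ 2)) => // N /= tN.
  by apply: lt_le_trans (truncnS_gt _) _; rewrite ler_nat.
have level a : v < a -> A (lim (p n @[n --> \oo])) /\ h (lim (p n @[n --> \oo])) <= a.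
  move=> va; apply: (@closed_cvg _ _ \oo _ p _ (h_closed (a := a))) => //.
  exists (Num.truncn (a - v)^-1) => // n /= tn.
  have [An hn] := pP n; split => //; apply: le_trans (ltW hn) _.
  rewrite -lerBrDl invf_ple ?posrE ?subr_gt0//.
  by apply: le_trans (ltW (truncnS_gt _)) _; rewrite ler_nat.
exists (lim (p n @[n --> \oo])); split.
  by have [] := level (v + 1) (ltr_pwDr ltr01 (lexx v)).
move=> z /vle; apply: le_trans; apply/ler_addgt0Pr => e e0.
by have [] := level (v + e) (ltr_pwDr e0 (lexx v)).
Unshelve. all: by end_near. Qed.

Lemma strongly_convex_minimizer_unique p q : A p -> A q ->
  (forall z, A z -> h p <= h z) -> (forall z, A z -> h q <= h z) -> p = q.
Proof.
move=> Ap Aq hp hq.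
have half : 0 < (2^-1 : R) < 1 by rewrite invr_gt0 ltr0Sn invf_lt1// ltr1n.
have := h_convex Ap Aq half; have := hp _ (A_convex Ap Aq half).
have := hq _ Ap; set W := h _; set c := _ ^+ 2.
have -> : 2^-1 * (1 - 2^-1) * (m / 2 * c) = c * m / 8 by field.
move=> h1 h2 h3; apply/eqP; rewrite -subr_eq0 -normr_eq0 -sqrf_eq0 -/c.
have cm : c * m <= 0 by lra.
by rewrite eq_le exprn_ge0// andbT; rewrite pmulr_lle0 in cm.
Qed.

End strongly_convex_minimization.

(** * Directional derivatives and the descent lemma *)

Section directional_derivatives.
Context {R : realType} {X : completeNormedModType R}.
Implicit Types (h : X -> R^o).

Lemma derive_le_of_secants h (p v : X) (a c : R) : derivable h p v ->
  (forall t, 0 < t < 1 -> h (p + t *: v) - h p <= t * (a + t * c)) ->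
  'D_v h p <= a.
Proof.
move=> dh hle.
have cq : (t^-1 *: (h (t *: v + p) - h p) - t * c) @[t --> (0 : R)^'+] --> 'D_v h p.
  rewrite -[X in _ --> X]subr0 -[X in _ - X](mul0r c).
  apply: cvgB; first exact: cvg_dnbhs_at_right dh.
  apply: cvgM; last exact: cvg_cst.
  by apply: cvg_at_right_filter; exact: cvg_id.
apply: (cvgr_to_le cq).
near=> t.
have t0 : 0 < t by near: t; exact: nbhs_right_gt.
have t1 : t < 1 by near: t; exact: nbhs_right_lt.
have := hle t; rewrite t0 t1 => /(_ isT).
by move=> h1; rewrite lerBlDr [_ *: v + p]addrC /GRing.scale/= ler_pdivrMl//.
Unshelve. all: by end_near. Qed.

Lemma derive_ge_of_secants h (p v : X) (a : R) : derivable h p v ->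
  (forall t, 0 < t < 1 -> t * a <= h (p + t *: v) - h p) ->
  a <= 'D_v h p.
Proof.
move=> dh hge; rewrite -lerN2 -deriveN//.
apply: (@derive_le_of_secants _ _ _ _ 0); first exact: derivableN.
move=> t /hge ht; rewrite mulr0 addr0 mulrN.
change (- h (p + t *: v) - - h p <= - (t * a)); lra.
Qed.

(** For [c = 0] this is the gradient inequality; for the modulus [c] of a uniformly
convex function it bounds its Bregman divergence below. *)
Lemma derive_le_of_convex h (x y : X) (c : R) : derivable h y (x - y) ->
  (forall t, 0 < t < 1 ->
    h (t *: x + (1 - t) *: y) + t * (1 - t) * c <= t * h x + (1 - t) * h y) ->
  'D_(x - y) h y + c <= h x - h y.
Proof.
move=> dh hc; rewrite -lerBrDr.
apply: (@derive_le_of_secants _ _ _ _ c) => // t /hc.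
have -> : t *: x + (1 - t) *: y = y + t *: (x - y).
  by rewrite scalerBl scale1r scalerBr addrCA.
move=> h1; move: h1; rewrite !mulrBr !mulrDr !mulrBl; lra.
Qed.

Lemma is_derive_line h (y d : X) (t : R) : derivable h (y + t *: d) d ->
  is_derive t (1 : R) (fun s : R => h (y + s *: d) : R) ('D_d h (y + t *: d)).
Proof.
move=> dh.
pose line (s : R) : R := h (y + s *: d).
have E : (fun s : R => s^-1 *: ((line \o shift t) (s *: (1 : R)) - h (y + t *: d))) =
         (fun s : R => s^-1 *: ((h \o shift (y + t *: d)) (s *: d) - h (y + t *: d))).
  apply/funext => s /=; congr (_ *: (h _ - _)).
  rewrite (_ : s *: (1 : R) = s); last by rewrite /GRing.scale/= mulr1.
  by rewrite scalerDl addrCA.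
by split; [rewrite /derivable E|rewrite /derive E].
Qed.

End directional_derivatives.

Section lipschitz_gradient.
Context {R : realType} {X : completeNormedModType R}.
Variables (f : X -> R^o).

Lemma lipschitz_smallest D K : 0 <= K -> gradient_lipschitz f D K ->
  [/\ 0 <= smallest_lipschitz f D, gradient_lipschitz f D (smallest_lipschitz f D)
    & smallest_lipschitz f D <= K].
Proof.
move=> K0 DK; rewrite /smallest_lipschitz; set E := [set K | _].
have E0 : E !=set0 by exists K.
have lE : lbound E 0 by move=> ? [].
have hE : has_lbound E by exists 0.
split; [exact: lb_le_inf | | exact: ge_inf].
move=> x y Dx Dy.
have [->|xy] := eqVneq x y.
  by have := DK y y Dy Dy; rewrite !subrr normr0 !mulr0.
have nxy : 0 < `|x - y| by rewrite normr_gt0 subr_eq0.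
rewrite -ler_pdivrMr//; apply: lb_le_inf => // k [k0 Dk].
by rewrite ler_pdivrMr//; exact: Dk.
Qed.

Lemma smallest_lipschitzS D D' K : D `<=` D' -> 0 <= K -> gradient_lipschitz f D' K ->
  smallest_lipschitz f D <= smallest_lipschitz f D'.
Proof.
move=> DD' K0 /(lipschitz_smallest K0)[s0 sl _].
by have [] := @lipschitz_smallest D _ s0 (fun x y Dx Dy => sl x y (DD' _ Dx) (DD' _ Dy)).
Qed.

(** Mean value theorem for [f] minus its quadratic upper model on the segment. *)
Lemma descent_lemma D K (y p : X) :
  (forall x, D x -> gateaux_differentiable f x) ->
  (forall t, 0 <= t <= 1 -> D (y + t *: (p - y))) ->
  gradient_lipschitz f D K ->
  f p <= f y + gradient f y (p - y) + K / 2 * `|p - y| ^+ 2.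
Proof.
move=> fd Dyp fK; set d := p - y.
pose F (s : R) : R := f (y + s *: d) - (s * gradient f y d + s ^+ 2 * (K / 2 * `|d| ^+ 2)).
pose dF (s : R) : R := gradient f (y + s *: d) d - (gradient f y d + s * (K * `|d| ^+ 2)).
have isF (s : R) : 0 <= s <= 1 -> is_derive s (1 : R) F (dF s).
  move=> s01.
  have h1 : is_derive s (1 : R) (fun s : R => f (y + s *: d) : R) ('D_d f (y + s *: d)).
    by apply: is_derive_line; have [] := fd _ (Dyp _ s01).
  have h2 : is_derive s (1 : R)
      (fun s : R => s * gradient f y d + s ^+ 2 * (K / 2 * `|d| ^+ 2) : R)
      (gradient f y d + s * (K * `|d| ^+ 2)).
    apply: is_derive_eq.
    by rewrite /GRing.scale /=; field.
  by have := is_deriveB h1 h2.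
have [||c c01] := @MVT R F dF 0 1 ltr01.
- by move=> s; rewrite in_itv/= => /andP[s0 s1]; apply: isF; rewrite !ltW.
- apply: derivable_within_continuous => s; rewrite in_itv/= => s01.
  by have := isF s s01; case.
rewrite subr0 mulr1 {isF} /F /dF scale1r scale0r addr0 mul1r mul0r.
rewrite !expr0n/= expr1n mul1r mul0r addr0 subr0.
rewrite [y + d]addrC subrK.
move: c01; rewrite in_itv/= => /andP[c0 c1].
have c01 : 0 <= c <= 1 by rewrite !ltW.
have y0 : D y by have := Dyp 0; rewrite scale0r addr0; apply; rewrite lexx ler01.
have [_ d1] := fd _ (Dyp _ c01); have [_ d2] := fd _ y0.
have := dual_normP (dual_sub d1 d2) d; have := fK _ _ (Dyp _ c01) y0.
rewrite addrAC subrr add0r normrZ gtr0_norm// => h1 h2.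
have := le_trans h2 (ler_wpM2r (normr_ge0 d) h1).
move=> /(le_trans (ler_norm _)).
have -> : K * (c * `|d|) * `|d| = c * (K * `|d| ^+ 2) by ring.
lra.
Qed.

End lipschitz_gradient.

(** * Convexity and lower semicontinuity of extended real functions *)

Section real_values.
Context {R : realType} {X : completeNormedModType R}.

Lemma fine_convex (hx hy hz : \bar R) (t c : R) :
  hx \is a fin_num -> hy \is a fin_num -> (-oo < hz)%E ->
  (hz + c%:E <= t%:E * hx + (1 - t)%:E * hy)%E ->
  hz \is a fin_num /\ fine hz + c <= t * fine hx + (1 - t) * fine hy.
Proof.
by case: hx => // hx; case: hy => // hy; case: hz.
Qed.

End real_values.

Section convex_sets.
Context {R : realType} {X : completeNormedModType R}.
Implicit Types (S : set X).

Lemma convex_setP S : convex_set (S : set (convex_lmodType X)) ->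
  forall (x y : X) (t : R), S x -> S y -> 0 <= t <= 1 -> S (t *: x + (1 - t) *: y).
Proof.
move=> cS x y t Sx Sy /andP[t0 t1].
by have := cS x y (Itv01 t0 t1) (mem_set Sx) (mem_set Sy); rewrite inE.
Qed.

Lemma convex_functionP S (f : X -> R^o) : convex_function (S : set (convex_lmodType X)) f ->
  forall (x y : X) (t : R), S x -> S y -> 0 <= t <= 1 ->
  f (t *: x + (1 - t) *: y) <= t * f x + (1 - t) * f y.
Proof.
move=> cf x y t Sx Sy /andP[t0 t1].
exact: (cf (Itv01 t0 t1) x y (mem_set Sx) (mem_set Sy)).
Qed.

End convex_sets.

Section lower_semicontinuity.
Context {R : realType} {X : completeNormedModType R}.
Implicit Types (S : set X) (u v : X -> \bar R).
Local Open Scope ereal_scope.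

Let nbhsE_in S (x : X) : S x -> nbhs (x : subspace S) = within S (nbhs x).
Proof. by move=> Sx; rewrite nbhs_subspace_in. Qed.

Let nbhsE_out S (x : X) : ~ S x -> nbhs (x : subspace S) = globally [set x].
Proof. by move=> nSx; rewrite (@nbhs_subspace_out X S x nSx). Qed.

Lemma lsc_onP S u : lsc_on S u <-> forall x (a : R), S x -> a%:E < u x ->
  exists2 e, (0 < e)%R & forall y, S y -> (`|x - y| < e)%R -> a%:E < u y.
Proof.
split=> [lu x a Sx aux|h x a aux].
  have [V + Vu] := lu x a aux; rewrite (nbhsE_in Sx) /= => xV.
  have /nbhs_normP[e e0 eV] := xV.
  by exists e => // y Sy xy; apply/Vu/eV.
have [Sx|nSx] := pselect (S x).
  have [e e0 eu] := h x a Sx aux.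
  exists ([set y : X | (`|x - y| < e)%R] `&` S); last by move=> y [/= xy Sy]; exact: eu.
  by rewrite (nbhsE_in Sx); apply/nbhs_normP; exists e => // y /= xy Sy.
exists [set x]; last by move=> y ->.
by rewrite (nbhsE_out nSx) => y ->.
Qed.

Lemma lsc_on_subset S S' u : S `<=` S' -> lsc_on S' u -> lsc_on S u.
Proof.
move=> SS' /lsc_onP h; apply/lsc_onP => x a Sx /h; move=> /(_ (SS' _ Sx))[e e0 eu].
by exists e => // y /SS'; exact: eu.
Qed.

Lemma lower_semicontinuous_on S u : lower_semicontinuous u -> lsc_on S u.
Proof.
move=> lu; apply/lsc_onP => x a Sx /lu[V /nbhs_normP[e e0 eV] Vu].
by exists e => // y Sy xy; apply/Vu/eV.
Qed.

Lemma continuous_lsc_on S (h : X -> R^o) : continuous h -> lsc_on S (fun x => (h x)%:E).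
Proof.
move=> ch; apply: lower_semicontinuous_on => x a; rewrite lte_fin => ax.
exists [set y | (a < h y)%R] => //.
exact: (@cvgr_gt _ _ _ _ h (h x) (ch x) a ax).
Qed.

Lemma split_lt_add (x y : \bar R) (a : R) : -oo < x -> -oo < y -> a%:E < x + y ->
  exists a1 a2 : R, [/\ a1%:E < x, a2%:E < y & (a <= a1 + a2)%R].
Proof.
case: x => [x| |]// _; case: y => [y| |]// _.
- rewrite -EFinD lte_fin => axy; exists (x - (x + y - a) / 2)%R, (y - (x + y - a) / 2)%R.
  by rewrite !lte_fin; split; lra.
- move=> _; exists (x - 1)%R, (a - x + 1)%R; rewrite lte_fin ltry; split => //; lra.
- move=> _; exists (a - y + 1)%R, (y - 1)%R; rewrite lte_fin ltry; split => //; lra.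
- by move=> _; exists a, 0%R; rewrite !ltry addr0.
Qed.

Lemma lsc_onD S u v : (forall x, S x -> -oo < u x) -> (forall x, S x -> -oo < v x) ->
  lsc_on S u -> lsc_on S v -> lsc_on S (fun x => u x + v x).
Proof.
move=> uoo voo /lsc_onP lu /lsc_onP lv; apply/lsc_onP => x a Sx.
move=> /(split_lt_add (uoo _ Sx) (voo _ Sx))[a1 [a2 [a1u a2v aa]]].
have [e1 e10 h1] := lu _ _ Sx a1u; have [e2 e20 h2] := lv _ _ Sx a2v.
exists (Num.min e1 e2); first by rewrite lt_min e10.
move=> y Sy; rewrite lt_min => /andP[y1 y2].
by apply: (@le_lt_trans _ _ (a1%:E + a2%:E)); [rewrite -EFinD lee_fin|rewrite lteD// ?h1 ?h2].
Qed.

Lemma lsc_onZ S u (c : R) : (0 < c)%R -> lsc_on S u -> lsc_on S (fun x => c%:E * u x).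
Proof.
move=> c0 /lsc_onP lu; apply/lsc_onP => x a Sx acu.
have E z : (a%:E < c%:E * z) = ((a / c)%:E < z).
  rewrite -[RHS](@lte_pmul2l _ c%:E) ?lte_fin//.
  by rewrite -EFinM mulrC divfK// gt_eqF.
have [|e e0 eu] := lu x (a / c)%R Sx; first by rewrite -E.
by exists e => // y Sy xy; rewrite E; exact: eu.
Qed.

Lemma lsc_on_sublevel S u (a : R) : closed S -> lsc_on S u ->
  closed [set x | S x /\ u x <= a%:E].
Proof.
move=> cS /lsc_onP lu x cx.
have Sx : S x by apply: cS; apply: closureS cx => y [].
split => //; rewrite leNgt; apply/negP => aux.
have [e e0 eu] := lu _ _ Sx aux.
have /closure_normP/(_ e e0)[y [Sy uy] xy] := cx.
by have := eu y Sy xy; rewrite ltNge uy.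
Qed.

End lower_semicontinuity.

(** * Bregman divergences *)

Section bregman_functions.
Context {R : realType} {X : completeNormedModType R}.
Variable b : X -> \bar R.
Hypothesis b_bregman : semi_bregman b.

Let br (x : X) : R := fine (b x).

(** The Bregman divergence without the convention [+oo]: it agrees with
[divergence b x y] for [x] in the domain and [y] in the zone. *)
Definition bregman_div (x y : X) : R := br x - br y - (bgrad b y (x - y) : R).

Lemma dom_fin x : dom b x -> b x \is a fin_num.
Proof. by have [[bN _ _] _] := b_bregman; rewrite fin_numE => bx; rewrite gt_eqF ?bN// lt_eqF. Qed.

Lemma domP x : dom b x -> b x = (br x)%:E.
Proof. by move=> /dom_fin bx; rewrite /br fineK. Qed.

Lemma zone_dom y : zone b y -> dom b y.
Proof. exact: interior_subset. Qed.

Lemma zone_nbhs y : zone b y -> exists2 e, 0 < e & forall x, `|y - x| < e -> dom b x.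
Proof. by move=> /nbhs_normP[e e0 he]; exists e => // x; exact: he. Qed.

Lemma zone_gateaux y : zone b y -> gateaux_differentiable (br : X -> R^o) y.
Proof. by have [[_ _ h] _] := b_bregman; exact: h. Qed.

Lemma bgrad_dual y : zone b y -> dual (bgrad b y).
Proof. by move=> /zone_gateaux[]. Qed.

Lemma dom_convex x y (t : R) : dom b x -> dom b y -> 0 < t < 1 ->
  dom b (t *: x + (1 - t) *: y) /\ br (t *: x + (1 - t) *: y) <= t * br x + (1 - t) * br y.
Proof.
move=> dx dy t01; have [[bN _ _] [bc _ _]] := b_bregman.
have [|zfin h] := @fine_convex _ _ _ (b (t *: x + (1 - t) *: y)) t 0
  (dom_fin dx) (dom_fin dy) (bN _).
  by rewrite adde0; exact: bc.
by split; [rewrite /dom/= ltey_eq zfin|rewrite addr0 in h].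
Qed.

(** A ball around [y] inside the domain is contracted towards [x] by the convex
combination, and its image is a neighborhood inside the domain. *)
Lemma zone_segment x y (t : R) : dom b x -> zone b y -> 0 <= t < 1 ->
  zone b (t *: x + (1 - t) *: y).
Proof.
move=> dx zy /andP[t0 t1]; have [e e0 he] := zone_nbhs zy.
move: t0; rewrite le_eqVlt => /predU1P[<-|t0].
  by rewrite scale0r add0r subr0 scale1r.
have t10 : 0 < 1 - t by rewrite subr_gt0.
apply/nbhs_normP; exists ((1 - t) * e); first by rewrite /= mulr_gt0.
move=> w /= hw.
(* the point of which [w] is the image under the contraction towards [x] *)
pose w' := (1 - t)^-1 *: (w - t *: x).
have -> : w = t *: x + (1 - t) *: w'.
  by rewrite /w' scalerA divff ?gt_eqF// scale1r addrC subrK.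
apply: (dom_convex dx _ _).1; last by rewrite t0.
apply: he; rewrite -(ltr_pM2l t10); apply: le_lt_trans hw.
rewrite -{1}(gtr0_norm t10) -normrZ scalerBr /w' scalerA divff ?gt_eqF// scale1r.
by rewrite opprB addrCA addrA.
Qed.

Lemma zone_convex y z (t : R) : zone b y -> zone b z -> 0 <= t <= 1 ->
  zone b (t *: y + (1 - t) *: z).
Proof.
move=> zy zz /andP[t0]; rewrite le_eqVlt => /predU1P[->|t1].
  by rewrite subrr scale0r addr0 scale1r.
by apply: zone_segment; rewrite ?t0//; exact: zone_dom.
Qed.

Lemma divergenceE x y : dom b x -> zone b y -> divergence b x y = (bregman_div x y)%:E.
Proof.
move=> dx zy; rewrite /divergence !mem_set//= (domP dx) (domP (zone_dom zy)).
by rewrite -!EFinB.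
Qed.

Lemma bregman_div_ge_modulus x y (c : R) : dom b x -> zone b y ->
  (forall t, 0 < t < 1 ->
    br (t *: x + (1 - t) *: y) + t * (1 - t) * c <= t * br x + (1 - t) * br y) ->
  c <= bregman_div x y.
Proof.
move=> dx zy hc; have [dg _] := zone_gateaux zy.
have := @derive_le_of_convex _ _ br x y c (dg _) hc.
by rewrite /bregman_div /bgrad /gradient -/br; lra.
Qed.

Lemma bregman_div_ge0 x y : dom b x -> zone b y -> 0 <= bregman_div x y.
Proof.
move=> dx zy; apply: bregman_div_ge_modulus => // t t01.
by rewrite mulr0 addr0; have [] := dom_convex dx (zone_dom zy) t01.
Qed.

Lemma bregman_divxx y : zone b y -> bregman_div y y = 0.
Proof. by move=> zy; rewrite /bregman_div !subrr dual0 ?subrr//; have [] := zone_gateaux zy. Qed.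

Lemma strongly_convex_fine S m x y (t : R) : strongly_convex_on b S m -> S `<=` dom b ->
  S x -> S y -> 0 < t < 1 ->
  br (t *: x + (1 - t) *: y) + t * (1 - t) * (m / 2 * `|x - y| ^+ 2) <=
    t * br x + (1 - t) * br y.
Proof.
move=> [m0 [_ h]] Sd Sx Sy t01; have [[bN _ _] _] := b_bregman.
by have [] := fine_convex (dom_fin (Sd _ Sx)) (dom_fin (Sd _ Sy)) (bN _) (h x y t Sx Sy t01).
Qed.

Lemma bregman_div_ge_sqr S m x y : strongly_convex_on b S m -> S `<=` dom b ->
  S x -> S y -> zone b y -> m / 2 * `|x - y| ^+ 2 <= bregman_div x y.
Proof.
move=> bS Sd Sx Sy zy; apply: bregman_div_ge_modulus => //; first exact: Sd.
by move=> t t01; exact: strongly_convex_fine bS Sd _ _ _.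
Qed.

Lemma three_points x p y : zone b p -> zone b y ->
  bregman_div x y - bregman_div p y - bregman_div x p =
    (bgrad b p (x - p) : R) - (bgrad b y (x - p) : R).
Proof.
move=> zp zy.
have := dualD (bgrad_dual zy) (x - p) (p - y); rewrite subrKA /bregman_div; lra.
Qed.

Lemma convex_gradient_ineq (f : X -> R^o) x y :
  convex_function (dom b : set (convex_lmodType X)) f ->
  gateaux_differentiable f y -> dom b x -> dom b y ->
  f y + gradient f y (x - y) <= f x.
Proof.
move=> cf [df _] dx dy.
have := @derive_le_of_convex _ _ f x y 0 (df _).
rewrite addr0 /gradient => h; suff : 'D_(x - y) f y <= f x - f y by lra.
apply: h => t /andP[t0 t1]; rewrite mulr0 addr0.
by apply: (convex_functionP cf) => //; rewrite !ltW.
Qed.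

End bregman_functions.

(** * The proximal operation *)

Lemma ltNy_add {R : realType} (x y : \bar R) : (-oo < x -> -oo < y -> -oo < x + y)%E.
Proof. by case: x => [r| |]; case: y => [s| |]//; rewrite -?EFinD ?ltNyr. Qed.

Section prox_theory.
Context {R : realType} {X : completeNormedModType R}.
Variables (b : X -> \bar R) (f : X -> R^o) (g : X -> \bar R) (C : set X).
Hypothesis b_bregman : semi_bregman b.
Hypothesis C_dom : C `<=` dom b.
Hypothesis f_convex : convex_function (dom b : set (convex_lmodType X)) f.
Hypothesis f_gateaux : forall y, zone b y -> gateaux_differentiable f y.
Hypothesis g_ninfty : forall x, C x -> (-oo < g x)%E.
Hypothesis g_convex : econvex_on C g.
Hypothesis g_lsc : lsc_on C g.

Let gr (x : X) : R := fine (g x).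

Lemma g_fin x : C x -> (g x < +oo)%E -> g x = (gr x)%:E.
Proof. by move=> Cx gx; rewrite /gr fineK// fin_numElt g_ninfty. Qed.

Lemma g_convex_fin x y (t : R) : C x -> C y -> (g x < +oo)%E -> (g y < +oo)%E -> 0 < t < 1 ->
  C (t *: x + (1 - t) *: y) ->
  (g (t *: x + (1 - t) *: y)%R < +oo)%E /\
  gr (t *: x + (1 - t) *: y) <= t * gr x + (1 - t) * gr y.
Proof.
move=> Cx Cy gx gy t01 Cz.
have [||||zf] := @fine_convex _ (g x) (g y) (g (t *: x + (1 - t) *: y)) t 0.
- by rewrite g_fin.
- by rewrite g_fin.
- exact: g_ninfty.
- by rewrite adde0; exact: g_convex.
by rewrite addr0 => ->; rewrite ltey_eq zf.
Qed.

(** [m] is the strong convexity parameter on [S], whereas [mu] only enters the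
weight [K / mu] of the divergence. *)
Section prox.
Variables (S : set X) (m K mu : R) (y : X).
Hypothesis S_closed : closed S.
Hypothesis S_convex : convex_set (S : set (convex_lmodType X)).
Hypothesis SC : S `<=` C.
Hypothesis S_strong : strongly_convex_on b S m.
Hypothesis g_proper : exists2 z, S z & (g z < +oo)%E.
Hypothesis K0 : 0 < K.
Hypothesis mu0 : 0 < mu.
Hypothesis zy : zone b y.

Let c := K / mu.
Let c0 : 0 < c. Proof. exact: divr_gt0. Qed.
Let m0 : 0 < m. Proof. by have [] := S_strong. Qed.
Let A : set X := [set z | S z /\ (g z < +oo)%E].
Let q (z : X) : R := f y + (gradient f y (z - y) : R) + c * bregman_div b z y + gr z.
Let p := prox b f g K mu S y.

Let QE z : A z -> Q b f g K mu z y = (q z)%:E.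
Proof.
move=> [Sz gz]; rewrite /Q divergenceE//; last exact/C_dom/SC.
by rewrite (g_fin (SC Sz) gz) -EFinM -!EFinD.
Qed.

Let Qoo z : S z -> ~~ (g z < +oo)%E -> Q b f g K mu z y = +oo%E.
Proof.
move=> Sz; rewrite -leNgt leye_eq => /eqP gz; rewrite /Q divergenceE//; last exact/C_dom/SC.
by rewrite gz -EFinM -!EFinD addey.
Qed.

Let A_nonempty : A !=set0.
Proof. by have [z Sz gz] := g_proper; exists z. Qed.

Let A_convex u v (t : R) : A u -> A v -> 0 < t < 1 -> A (t *: u + (1 - t) *: v).
Proof.
move=> [Su gu] [Sv gv] /[dup] t01 /andP[t0 t1].
have Sz : S (t *: u + (1 - t) *: v) by apply: convex_setP => //; rewrite !ltW.
by split=> //; have [] := g_convex_fin (SC Su) (SC Sv) gu gv t01 (SC Sz).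
Qed.

Let dual_convex (l : X -> R^o) (dl : dual l) u v (t : R) :
  l (t *: u + (1 - t) *: v - y) = t * (l (u - y) : R) + (1 - t) * (l (v - y) : R) :> R.
Proof.
have -> : t *: u + (1 - t) *: v - y = t *: (u - y) + (1 - t) *: (v - y).
  rewrite !scalerBr addrACA -opprD -scalerDl.
  by rewrite (_ : t + (1 - t) = 1) ?scale1r//; ring.
have [dD dZ] := (dualD dl, dualZ dl).
by rewrite dD !dZ.
Qed.

Let q_convex u v (t : R) : A u -> A v -> 0 < t < 1 ->
  q (t *: u + (1 - t) *: v) + t * (1 - t) * (c * m / 2 * `|u - v| ^+ 2) <=
  t * q u + (1 - t) * q v.
Proof.
move=> [Su gu] [Sv gv] t01.
have [Sz _] := A_convex (conj Su gu) (conj Sv gv) t01.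
have [_ dfy] := f_gateaux zy.
have [_ hg] := g_convex_fin (SC Su) (SC Sv) gu gv t01 (SC Sz).
have hb := strongly_convex_fine b_bregman S_strong (fun x Sx => C_dom (SC Sx)) Su Sv t01.
rewrite /q /bregman_div !(dual_convex dfy) !(dual_convex (bgrad_dual b_bregman zy)).
move: hg; set gz := gr _; set n := `|_ - _| ^+ 2 => hg.
have := ler_wpM2l (ltW c0) hb; move: hg; set bz := fine (b (_ + _)).
rewrite -/n /=.
have -> : c * m / 2 * n = c * (m / 2 * n) by ring.
lra.
Qed.

Let q_closed a : closed [set x | A x /\ q x <= a].
Proof.
(* [q] is a continuous affine function plus [c * b + g] *)
pose l z : R := f y + (gradient f y (z - y) : R) - c * (fine (b y) + (bgrad b y (z - y) : R)).
have lc : continuous (l : X -> R^o).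
  move=> z; have [_ [_ cfy]] := f_gateaux zy; have [_ cby] := bgrad_dual b_bregman zy.
  have sub : (z - y) @[z --> z] --> z - y by apply: cvgB; [exact: cvg_id|exact: cvg_cst].
  apply: cvgB.
    apply: cvgD; first exact: cvg_cst.
    exact: (cvg_comp _ _ sub (cfy _)).
  apply: cvgM; first exact: cvg_cst.
  apply: cvgD; first exact: cvg_cst.
  exact: (cvg_comp _ _ sub (cby _)).
have [[bN _ _] [_ blsc _]] := b_bregman.
have bN' x : (-oo < c%:E * b x)%E.
  by have := bN x; case: (b x) => // [r _|_]; rewrite -?EFinM ?ltNyr// gt0_muley ?lte_fin.
pose u z := ((l z)%:E + (c%:E * b z + g z))%E.
have ulsc : lsc_on S u.
  apply: lsc_onD => //.
  - by move=> x _; exact: ltNyr.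
  - by move=> x Sx; apply: ltNy_add => //; exact/g_ninfty/SC.
  - exact: (@continuous_lsc_on _ _ S (l : X -> R^o)).
  apply: lsc_onD => //.
  - by move=> x /SC; exact: g_ninfty.
  - by apply: lsc_onZ => //; exact: lower_semicontinuous_on.
  - exact: lsc_on_subset g_lsc.
have uE z : A z -> u z = (q z)%:E.
  move=> [Sz gz]; rewrite /u (g_fin (SC Sz) gz) (domP b_bregman (C_dom (SC Sz))).
  by rewrite -EFinM -!EFinD; congr (_%:E); rewrite /l /q /bregman_div; ring.
have -> : [set x | A x /\ q x <= a] = [set x | S x /\ (u x <= a%:E)%E].
  apply/seteqP; split=> x /=.
    by move=> [Ax qa]; rewrite uE// lee_fin; split => //; exact: Ax.1.
  move=> [Sx ux].
  suff Ax : A x by split => //; rewrite -lee_fin -uE.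
  split=> //; rewrite ltNge leye_eq; apply/negP => /eqP gx.
  by move: ux; rewrite /u gx addeC addey ?addey// ?gt_eqF// ?leye_eq// .
exact: lsc_on_sublevel.
Qed.

Let minimizerP z : S z -> (forall w, S w -> (Q b f g K mu z y <= Q b f g K mu w y)%E) ->
  A z /\ forall w, A w -> q z <= q w.
Proof.
move=> Sz zmin; have [a Aa] := A_nonempty.
have Az : A z.
  split=> //; apply: contrapT => /negP gz; have := zmin a Aa.1.
  by rewrite (Qoo Sz gz) QE// leye_eq.
by split=> // w Aw; rewrite -lee_fin -!QE//; apply: zmin; exact: Aw.1.
Qed.

Lemma prox_minimizes : S p /\ forall z, S z -> (Q b f g K mu p y <= Q b f g K mu z y)%E.
Proof.
apply: (@getPex _ [set p | S p /\ forall z, S z -> (Q b f g K mu p y <= Q b f g K mu z y)%E]).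
have [z [Az zmin]] := strongly_convex_minimizer_exists
  (mulr_gt0 c0 m0) A_nonempty A_convex q_convex q_closed.
exists z; split; first exact: Az.1.
move=> w Sw; have [gw|gw] := boolP (g w < +oo)%E; last by rewrite (Qoo Sw gw) leey.
by rewrite !QE// lee_fin zmin.
Qed.

(** Uniqueness identifies proximal points over different sets of a telescope. *)
Lemma prox_unique z : S z -> (forall w, S w -> (Q b f g K mu z y <= Q b f g K mu w y)%E) ->
  z = p.
Proof.
move=> Sz /(minimizerP Sz)[Az zq]; have [Sp /(minimizerP Sp)[Ap pq]] := prox_minimizes.
exact: (strongly_convex_minimizer_unique (mulr_gt0 c0 m0) A_convex q_convex).
Qed.

Lemma prox_finite : (g p < +oo)%E.
Proof. by have [Sp /(minimizerP Sp)[[]]] := prox_minimizes. Qed.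

(** First order optimality of [p]: the derivative of [c * b] at [p] in direction
[z - p] is at least the decrease of the rest of the model from [p] to [z], and the
three point identity rewrites it in terms of divergences. *)
Lemma prox_three_points z : zone b p -> S z -> (g z < +oo)%E ->
  f y + (gradient f y (p - y) : R) + c * bregman_div b p y + gr p + c * bregman_div b z p <=
  f y + (gradient f y (z - y) : R) + c * bregman_div b z y + gr z.
Proof.
move=> zp Sz gz.
have [Sp /(minimizerP Sp)[Ap pq]] := prox_minimizes.
have [_ dfy] := f_gateaux zy; have dby := bgrad_dual b_bregman zy.
have [derp _] := zone_gateaux b_bregman zp.
(* value at [p] minus value at [z] of the model without its term [c * b] *)
pose E := (gradient f y (p - z) : R) + gr p - gr z + c * (bgrad b y (z - p) : R).
have : E / c <= 'D_(z - p) (fun x => fine (b x) : R^o) p.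
  apply: derive_ge_of_secants => // t t01.
  have [Sw gw] := A_convex (conj Sz gz) Ap t01.
  have := pq _ (conj Sw gw).
  have [_] := g_convex_fin (SC Sz) (SC Sp) gz Ap.2 t01 (SC Sw).
  have -> : t *: z + (1 - t) *: p = p + t *: (z - p).
    by rewrite scalerBl scale1r scalerBr addrCA.
  rewrite /q /bregman_div; set w := p + _; set gw' := gr w.
  have -> : w - y = t *: (z - p) + (p - y) by rewrite /w addrAC addrC.
  rewrite (dualD dfy (t *: _)) (dualD dby (t *: _)) (dualZ dfy) (dualZ dby).
  rewrite /E -[p - z]opprB (dualN dfy).
  set G := (gradient f y (z - p) : R); set B := (bgrad b y (z - p) : R).
  move=> h1 h2; rewrite -(ler_pM2l c0) [X in X <= _]mulrCA.
  rewrite (mulrC c (_ / c)) divfK ?gt_eqF//.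
  move: h1 h2; lra.
have := three_points b_bregman z zp zy; rewrite /bgrad /gradient => h3.
rewrite ler_pdivrMr// mulrC => h4.
have h5 := dualB dfy (p - y) (z - y); rewrite opprB addrA subrK in h5.
move: h4; rewrite /E h5.
have := congr1 (fun x => c * x) h3; rewrite /bgrad /gradient !mulrBr.
lra.
Qed.

Hypothesis Sy : S y.
Hypothesis zp : zone b p.

(** The descent test bounds the objective at [p] by the left hand side of the three
point inequality, and the gradient inequality for [f] its right hand side by the
objective at [z].  The whole convergence analysis rests on this inequality. *)
Lemma prox_sufficient_decrease z : S z -> (g z < +oo)%E ->
  (objective f g C p <= Q b f g K mu p y)%E ->
  f p + gr p + c * bregman_div b z p <= f z + gr z + c * bregman_div b z y.
Proof.
move=> Sz gz.
have [Sp /(minimizerP Sp)[Ap pq]] := prox_minimizes.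
rewrite /objective mem_set; last exact: SC.
rewrite (g_fin (SC Sp) Ap.2) QE// -EFinD lee_fin /q => h1.
have h2 := prox_three_points zp Sz gz.
have := convex_gradient_ineq f_convex (f_gateaux zy) (C_dom (SC Sz)) (zone_dom zy).
lra.
Qed.

(** The descent lemma bounds [f p] by a quadratic model, and strong convexity bounds
the square of the norm by the Bregman divergence. *)
Lemma prox_descent L : m = mu -> 0 <= L -> gradient_lipschitz f (S `&` zone b) L -> L <= K ->
  (objective f g C p <= Q b f g K mu p y)%E.
Proof.
move=> mmu L0 fL LK.
have [Sp /(minimizerP Sp)[Ap pq]] := prox_minimizes.
rewrite /objective mem_set; last exact: SC.
rewrite (g_fin (SC Sp) Ap.2) QE// -EFinD lee_fin /q lerD2r.
have := @descent_lemma _ _ f (S `&` zone b) L y p (fun x h => f_gateaux h.2) _ fL.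
move=> /(_ _)/le_trans; apply; first move=> t t01.
  rewrite (_ : y + t *: (p - y) = t *: p + (1 - t) *: y); last first.
    by rewrite scalerBl scale1r scalerBr addrCA.
  by split; [exact: convex_setP|exact: (zone_convex b_bregman)].
rewrite lerD2l.
have := bregman_div_ge_sqr b_bregman S_strong (fun x Sx => C_dom (SC Sx)) Sp Sy zy.
move=> /(ler_wpM2l (ltW c0)); apply: le_trans.
rewrite mmu [c * _]mulrA ler_wpM2r ?sqr_ge0// /c (_ : K / mu * (mu / 2) = K / 2); first by lra.
by field; exact: lt0r_neq0.
Qed.

End prox.
End prox_theory.

(** * Convergence of the objective values and of the iterates *)

Lemma powR_nat_unbounded {R : realType} (s M : R) : 0 < s ->
  exists N : nat, forall k : nat, (N <= k)%N -> M <= k%:R `^ s.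
Proof.
move=> s0; exists (Num.truncn (`|M| `^ s^-1)).+1 => k Nk.
apply: le_trans (ler_norm M) _.
have -> : `|M| = (`|M| `^ s^-1) `^ s by rewrite -powRrM mulVf ?gt_eqF// powRr1.
apply: (ge0_ler_powR (ltW s0)); rewrite ?nnegrE ?powR_ge0//.
by apply: le_trans (ltW (truncnS_gt _)) _; rewrite ler_nat.
Qed.

Lemma powR_onem {R : realType} (x q : R) : 0 < x -> x `^ (1 - q) = x / x `^ q.
Proof. by move=> x0; rewrite powRB ?powRr1 ?(ltW x0)// (gt_eqF x0) implybT. Qed.

Lemma add_le_fin_ltey {R : realType} (a r : R) (y : \bar R) :
  (a%:E + y <= r%:E -> y < +oo)%E.
Proof. by case: y => [s _| |]; rewrite ?ltry. Qed.

Section minimizers.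
Context {R : realType} {X : completeNormedModType R}.
Variables (b : X -> \bar R) (f : X -> R^o) (g : X -> \bar R) (C : set X).
Hypothesis g_ninfty : forall x, C x -> (-oo < g x)%E.
Hypothesis g_proper : exists2 x, C x & (g x < +oo)%E.

Definition real_objective (z : X) : R := (f z : R) + fine (g z).

Lemma objectiveE z : C z -> (g z < +oo)%E -> objective f g C z = (real_objective z)%:E.
Proof. by move=> Cz gz; rewrite /objective mem_set// (g_fin g_ninfty Cz gz). Qed.

Lemma minimizersP z : minimizers f g C z <->
  [/\ C z, (g z < +oo)%E & forall w, C w -> (g w < +oo)%E -> real_objective z <= real_objective w].
Proof.
rewrite /minimizers /=; split.
  move=> [Cz zo].
  have le w : C w -> (objective f g C z <= objective f g C w)%E.
    by move=> Cw; rewrite zo; apply: ereal_inf_lbound; exists w.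
  have gz : (g z < +oo)%E.
    have [w Cw gw] := g_proper.
    apply: contrapT => /negP; rewrite -leNgt leye_eq => /eqP gz.
    by have := le w Cw; rewrite (objectiveE Cw gw) /objective mem_set// gz addey.
  by split=> // w Cw gw; rewrite -lee_fin -!objectiveE// le.
move=> [Cz gz zle]; split=> //; rewrite objectiveE//; apply/eqP; rewrite eq_le.
apply/andP; split; last by apply: ereal_inf_lbound; exists z; rewrite ?objectiveE.
apply: le_ereal_inf_tmp => _ [w Cw <-].
have [gw|] := boolP (g w < +oo)%E; first by rewrite objectiveE// lee_fin zle.
by rewrite -leNgt leye_eq => /eqP gw; rewrite /objective mem_set// gw addey// leey.
Qed.

Lemma optimal_valueE z : minimizers f g C z -> optimal_value f g C = (real_objective z)%:E.
Proof. by move=> /[dup] /minimizersP[Cz gz _] [_ <-]; rewrite objectiveE. Qed.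

End minimizers.

(** The analysis retains of a run only that its iterates stay in an increasing
sequence of sets exhausting [C], that the weights are nondecreasing, and the
sufficient decrease property. *)
Section convergence.
Context {R : realType} {X : completeNormedModType R}.
Variables (b : X -> \bar R) (f : X -> R^o) (g : X -> \bar R) (C : set X) (mu : R).
Hypothesis b_bregman : semi_bregman b.
Hypothesis C_dom : C `<=` dom b.
Hypothesis C_closed : closed C.
Hypothesis C_convex : convex_set (C : set (convex_lmodType X)).
Hypothesis f_convex : convex_function (dom b : set (convex_lmodType X)) f.
Hypothesis f_lsc : lsc_on C (fun x => (f x)%:E).
Hypothesis g_ninfty : forall x, C x -> (-oo < g x)%E.
Hypothesis g_proper : exists2 x, C x & (g x < +oo)%E.
Hypothesis g_convex : econvex_on C g.
Hypothesis g_lsc : lsc_on C g.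
Hypothesis b_strong : strongly_convex_on b C mu.

Variables (T : nat -> set X) (L : nat -> R) (x : nat -> X).
Hypothesis T_incr : forall k, (0 < k)%N -> T k `<=` T k.+1.
Hypothesis TC : forall k, (0 < k)%N -> T k `<=` C.
Hypothesis T_cover : \bigcup_(k in [set k | (0 < k)%N]) T k = C.
Hypothesis xT : forall k, (0 < k)%N -> (T k `&` zone b) (x k).
Hypothesis gx : forall k, (0 < k)%N -> (g (x k.+1) < +oo)%E.
Hypothesis L0 : forall k, (0 < k)%N -> 0 < L k.
Hypothesis L_incr : forall k, (0 < k)%N -> L k <= L k.+1.
Hypothesis decrease : forall k z, (0 < k)%N -> T k.+1 z -> (g z < +oo)%E ->
  real_objective f g (x k.+1) + L k.+1 / mu * bregman_div b z (x k.+1) <=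
  real_objective f g z + L k.+1 / mu * bregman_div b z (x k).

Let F := real_objective f g.
Let mu0 : 0 < mu. Proof. by have [] := b_strong. Qed.
Let Tk j k : (0 < j)%N -> (j <= k)%N -> T j `<=` T k.
Proof.
move=> j0; elim: k => [|k IH]; first by rewrite leqn0 => /eqP j00; rewrite j00 in j0.
rewrite leq_eqVlt => /predU1P[->//|]; rewrite ltnS => jk.
by apply: subset_trans (IH jk) _; apply: T_incr; exact: leq_trans jk.
Qed.
Let xC k : (0 < k)%N -> C (x k). Proof. by move=> k0; apply: (TC k0); exact: (xT k0).1. Qed.
Let xz k : (0 < k)%N -> zone b (x k). Proof. by move=> /xT[]. Qed.
Let c0 k : (0 < k)%N -> 0 < L k / mu. Proof. by move=> k0; rewrite divr_gt0// L0. Qed.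
Let D0 z k : C z -> (0 < k)%N -> 0 <= bregman_div b z (x k).
Proof. by move=> Cz k0; apply: (bregman_div_ge0 b_bregman); [exact: C_dom|exact: xz]. Qed.

Lemma objective_nonincreasing k : (0 < k)%N -> F (x k.+2) <= F (x k.+1).
Proof.
move=> k0; have := decrease (ltn0Sn k) (T_incr (ltn0Sn _) (xT (ltn0Sn k)).1) (gx k0).
rewrite (bregman_divxx b_bregman); last exact: xz.
have := mulr_ge0 (ltW (c0 (ltn0Sn k.+1))) (D0 (xC (ltn0Sn k)) (ltn0Sn k.+1)).
rewrite /F; lra.
Qed.

Section from_minimizer.
Variables (z : X) (k0 : nat).
Hypothesis zmin : minimizers f g C z.
Hypothesis k00 : (0 < k0)%N.
Hypothesis Tz : T k0.+1 z.

Let Cz : C z. Proof. by have /minimizersP[] := zmin. Qed.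
Let gz : (g z < +oo)%E. Proof. by have /(minimizersP f g_ninfty g_proper)[] := zmin. Qed.
Let Fz k : (0 < k)%N -> F z <= F (x k.+1).
Proof.
move=> k_gt0; have /(minimizersP f g_ninfty g_proper)[_ _] := zmin; apply; first exact: xC.
exact: gx.
Qed.
Let step k : (k0 <= k)%N ->
  F (x k.+1) - F z <= L k.+1 / mu * (bregman_div b z (x k) - bregman_div b z (x k.+1)).
Proof.
move=> k0k; have k_gt0 : (0 < k)%N by exact: leq_trans k0k.
by have := decrease k_gt0 (Tk (ltn0Sn k0) (k0k : (k0 < k.+1)%N) Tz) gz; rewrite /F; lra.
Qed.

Lemma divergence_step k : (k0 <= k)%N -> bregman_div b z (x k.+1) <= bregman_div b z (x k).
Proof.
move=> k0k; have k_gt0 : (0 < k)%N by exact: leq_trans k0k.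
rewrite -subr_ge0 -(pmulr_rge0 _ (c0 (ltn0Sn k))).
by apply: le_trans (step k0k); rewrite subr_ge0 Fz.
Qed.

Lemma divergence_nonincreasing j k : (k0 <= j)%N -> (j <= k)%N ->
  bregman_div b z (x k) <= bregman_div b z (x j).
Proof.
move=> k0j; elim: k => [|k IH]; first by rewrite leqn0 => /eqP <-.
rewrite leq_eqVlt => /predU1P[->//|]; rewrite ltnS => jk.
by apply: le_trans (divergence_step (leq_trans k0j jk)) (IH jk).
Qed.

(** The induction carries the term [- B z (x k.+1)], which telescopes; the earlier
gaps are at least the last one and the earlier weights at most the last one. *)
Lemma objective_gap k : (k0 <= k)%N ->
  (k.+1%:R - k0%:R) * (F (x k.+1) - F z) <= L k.+1 / mu * bregman_div b z (x k0).
Proof.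
move=> k0k.
suff : (k.+1%:R - k0%:R) * (F (x k.+1) - F z) <=
    L k.+1 / mu * (bregman_div b z (x k0) - bregman_div b z (x k.+1)).
  move/le_trans; apply; rewrite ler_wpM2l ?(ltW (c0 _))// gerBl.
  by rewrite D0.
elim: k k0k => [|k IH] k0k; first by move: k00; rewrite ltnNge k0k.
move: k0k; rewrite leq_eqVlt => /predU1P[k0E|].
  rewrite -k0E (_ : k0.+1%:R - k0%:R = 1 :> R) ?mul1r; first exact: step.
  by rewrite -natr1; ring.
rewrite ltnS => k0k; have k_gt0 : (0 < k)%N by exact: leq_trans k0k.
have h1 := step (leq_trans k0k (leqnSn k)).
have n0 : 0 <= k.+1%:R - k0%:R :> R by rewrite subr_ge0 ler_nat (leq_trans k0k).
have h2 : (k.+1%:R - k0%:R) * (F (x k.+2) - F z) <=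
    L k.+2 / mu * (bregman_div b z (x k0) - bregman_div b z (x k.+1)).
  apply: le_trans (_ : _ <= (k.+1%:R - k0%:R) * (F (x k.+1) - F z)) _.
    by rewrite ler_wpM2l// lerB// objective_nonincreasing.
  apply: le_trans (IH k0k) _; apply: ler_wpM2r.
    by rewrite subr_ge0 divergence_nonincreasing// (leq_trans k0k).
  by rewrite ler_wpM2r ?invr_ge0 ?(ltW mu0)// L_incr.
have -> : k.+2%:R - k0%:R = (k.+1%:R - k0%:R) + 1 :> R by rewrite -[k.+2%:R]natr1; ring.
lra.
Qed.

Section rate.
Variables (alpha q : R).
Hypothesis alpha0 : 0 < alpha.
Hypothesis q01 : 0 < q < 1.
Hypothesis L_growth : forall k, (k0 < k)%N -> L k <= alpha * k%:R `^ q.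

Lemma objective_rate k : (k0 <= k)%N ->
  F (x k.+1) - F z <=
    k.+1%:R / (k.+1%:R - k0%:R) * (alpha / (mu * k.+1%:R `^ (1 - q))) * bregman_div b z (x k0).
Proof.
move=> k0k.
have n0 : 0 < k.+1%:R - k0%:R :> R by rewrite subr_gt0 ltr_nat ltnS.
rewrite powR_onem//.
have p0 : 0 < (k.+1%:R : R) `^ q by rewrite powR_gt0.
have -> : k.+1%:R / (k.+1%:R - k0%:R) * (alpha / (mu * (k.+1%:R / k.+1%:R `^ q)))
    * bregman_div b z (x k0)
  = (alpha * k.+1%:R `^ q / mu * bregman_div b z (x k0)) / (k.+1%:R - k0%:R).
  have N0 : 0 < k.+1%:R :> R by [].
  by move: N0 n0 p0; move: (k.+1%:R : R) => N *; field; rewrite !lt0r_neq0.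
rewrite ler_pdivlMr// mulrC; apply: le_trans (objective_gap k0k) _.
apply: ler_wpM2r; first exact: D0.
by rewrite ler_wpM2r ?invr_ge0 ?(ltW mu0)// L_growth.
Qed.

Lemma objective_converges : converges_at_rate f g C q x.
Proof.
have /andP[q0 q1] := q01.
pose M := 2 * (alpha / mu) * bregman_div b z (x k0).
have M0 : 0 <= M by rewrite mulr_ge0 ?D0// mulr_ge0// divr_ge0// ltW.
have bound k : (k0.*2 < k)%N -> F (x k) - F z <= M / k%:R `^ (1 - q).
  case: k => // k k0k; have k0k' : (k0 <= k)%N.
    by apply: leq_trans (leq_addr k0 k0) _; rewrite addnn.
  have n0 : 0 < k.+1%:R - k0%:R :> R by rewrite subr_gt0 ltr_nat ltnS.
  have p0 : 0 < (k.+1%:R : R) `^ (1 - q) by rewrite powR_gt0.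
  apply: le_trans (objective_rate k0k') _.
  have -> : M / k.+1%:R `^ (1 - q) =
      2 * (alpha / (mu * k.+1%:R `^ (1 - q))) * bregman_div b z (x k0).
    by rewrite /M; move: p0; move: (_ `^ _) => P ?; field; rewrite !lt0r_neq0.
  rewrite ler_wpM2r ?D0// ler_wpM2r//.
    by rewrite divr_ge0 ?(ltW alpha0)// ltW// mulr_gt0.
  rewrite ler_pdivrMr//.
  have : (k0.*2.+1)%:R <= k.+1%:R :> R by rewrite ler_nat.
  by rewrite -addnn -natr1 natrD; lra.
have xE k : (1 < k)%N -> objective f g C (x k) = (F (x k))%:E.
  by case: k => [|[|k]]// _; rewrite objectiveE//; [exact: xC|exact: gx].
split; last first.
  exists M; exists k0.*2.+2 => // k /= k0k.
  have k1 : (1 < k)%N by exact: leq_trans k0k.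
  rewrite xE// (optimal_valueE g_ninfty g_proper zmin) -EFinB lee_fin.
  by apply: bound; exact: ltnW.
rewrite (optimal_valueE g_ninfty g_proper zmin).
apply: cvg_EFin.
  by exists 2%N => // k /= k1; rewrite xE.
apply/cvgrPdist_lt => e e0.
have [|N hN] := @powR_nat_unbounded R (1 - q) ((M + 1) / e); first by rewrite subr_gt0.
exists (maxn N k0.*2.+2) => // k /=; rewrite geq_max => /andP[Nk k0k].
have k1 : (1 < k)%N by exact: leq_trans k0k.
rewrite xE//= distrC ger0_norm; last first.
  by case: k k1 {Nk k0k} => // k k1; rewrite subr_ge0 Fz.
apply: le_lt_trans (bound _ (ltnW k0k)) _.
have p0 : 0 < (k%:R : R) `^ (1 - q) by rewrite powR_gt0// ltr0n ltnW.
rewrite ltr_pdivrMr//; apply: lt_le_trans (_ : M + 1 <= _); first by rewrite ltrDl.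
by rewrite mulrC -ler_pdivrMr// hN.
Qed.

End rate.
End from_minimizer.

Section weak_convergence.
Variable q : R.
Hypothesis reflexive : reflexive_space (X := X).
Hypothesis min_nonempty : minimizers f g C !=set0.
Hypothesis min_zone : minimizers f g C `<=` zone b.
Hypothesis x_converges : converges_at_rate f g C q x.
Hypothesis bgrad_continuous : weak_to_weakstar_seq_continuous b.

Let T_index z : C z -> exists2 j, (0 < j)%N & T j.+1 z.
Proof. by rewrite -T_cover => -[j /= j0 Tz]; exists j => //; apply: T_incr. Qed.

Let objective_cvg z e : minimizers f g C z -> 0 < e ->
  exists N, forall k, (N <= k)%N -> F (x k) <= F z + e.
Proof.
move=> zmin e0; have [+ _] := x_converges.
rewrite (optimal_valueE g_ninfty g_proper zmin) => /fine_cvgP[_ /cvgrPdist_lt/(_ e e0)[N _ hN]].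
(* the objective is only known to be finite from the second iterate on *)
exists (maxn N 2) => k; rewrite geq_max => /andP[/hN/=].
case: k => [|[|k]]// + _; rewrite objectiveE//; [|exact: xC|exact: gx].
by rewrite distrC => /ltW/ler_normlP[_]; rewrite lerBlDl.
Qed.

(** The sublevel sets of the objective are convex and closed, so they contain the
weak limits of the iterates, which enter all of them above the minimum. *)
Let cluster_minimizer (phi : nat -> nat) z : (forall k, (k <= phi k)%N) ->
  weak_cvg (x \o phi) z -> minimizers f g C z.
Proof.
move=> phik xz'; have [zm zmin] := min_nonempty.
have /(minimizersP f g_ninfty g_proper)[Czm gzm zmle] := zmin.
have level e : 0 < e -> C z /\ ((f z)%:E + g z <= (F zm + e)%:E)%E.
  move=> e0.
  pose A := [set w | C w /\ ((f w)%:E + g w <= (F zm + e)%:E)%E].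
  have Ac : closed A.
    apply: lsc_on_sublevel => //; apply: lsc_onD => // w _; exact: ltNyr.
  have Afin w : A w -> (g w < +oo)%E.
    by move=> [_]; exact: add_le_fin_ltey.
  have Aconv u v t : A u -> A v -> 0 < t < 1 -> A (t *: u + (1 - t) *: v).
    move=> Au Av t01; have [gu gv] := (Afin _ Au, Afin _ Av).
    move: Au Av => [Cu +] [Cv].
    rewrite (g_fin g_ninfty Cu gu) (g_fin g_ninfty Cv gv) -!EFinD !lee_fin => Fu Fv.
    have t01' : 0 <= t <= 1 by case/andP: t01 => t0 t1; rewrite !ltW.
    have Cw := convex_setP C_convex Cu Cv t01'; split => //.
    have [gw hg] := g_convex_fin g_ninfty g_convex Cu Cv gu gv t01 Cw.
    rewrite (g_fin g_ninfty Cw gw) -EFinD lee_fin.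
    have := convex_functionP f_convex (C_dom Cu) (C_dom Cv) t01'.
    move: t01 => /andP[t0 t1].
    have h1 := ler_wpM2l (ltW t0) Fu; have h2 : 0 <= 1 - t by lra.
    have := ler_wpM2l h2 Fv; lra.
  have [N hN] := objective_cvg zmin e0.
  have AN k : (maxn N 2 <= k)%N -> A (x (phi k)).
    rewrite geq_max => /andP[Nk k2].
    have Nphi := leq_trans Nk (phik k); have phi2 := leq_trans k2 (phik k).
    have := hN _ Nphi; case: (phi k) phi2 => [|[|j]]// _ Fj.
    have Cj := xC (ltn0Sn j.+1); split => //.
    by rewrite (g_fin g_ninfty Cj (gx (ltn0Sn j))) -EFinD lee_fin.
  apply: (@weak_limit_in_convex_closed _ _ A _ _ _ \oo (x \o phi)) => //.
    by exists (x (phi (maxn N 2))); exact: AN.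
  by exists (maxn N 2) => // k; exact: AN.
apply/(minimizersP f g_ninfty g_proper).
have [Cz _] := level 1 ltr01.
have gz : (g z < +oo)%E.
  by have [_] := level 1 ltr01; exact: add_le_fin_ltey.
split=> // w Cw gw; apply: le_trans (zmle w Cw gw).
apply/ler_addgt0Pr => e /level[_].
by rewrite (g_fin g_ninfty Cz gz) -EFinD lee_fin.
Qed.

Let divergence_cvg z : minimizers f g C z -> cvg (bregman_div b z (x k) @[k --> \oo]).
Proof.
move=> zmin; have /(minimizersP f g_ninfty g_proper)[Cz _ _] := zmin.
have [j j0 Tz] := T_index Cz.
apply: (@near_nonincreasing_is_cvgn _ _ 0).
  exists j => // n /= jn m nm; exact: (divergence_nonincreasing zmin j0 Tz jn nm).
by exists 1%N => // k /= k0; exact: D0.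
Qed.

(** Opial's argument: [B z (x k) - B w (x k)] is affine in the gradient at [x k], and
converges because both divergences are eventually nonincreasing. *)
Let cluster_unique (phi psi : nat -> nat) z w :
  (forall k, (k <= phi k)%N) -> (forall k, (k <= psi k)%N) ->
  weak_cvg (x \o phi) z -> weak_cvg (x \o psi) w -> z = w.
Proof.
move=> phik psik xz' xw.
have zmin := cluster_minimizer phik xz'; have wmin := cluster_minimizer psik xw.
have /(minimizersP f g_ninfty g_proper)[Cz _ _] := zmin.
have /(minimizersP f g_ninfty g_proper)[Cw _ _] := wmin.
have [zz zw] := (min_zone zmin, min_zone wmin).
pose u k : R := bgrad b (x k) (z - w).
have uE k : (0 < k)%N ->
    u k = fine (b z) - fine (b w) - (bregman_div b z (x k) - bregman_div b w (x k)).
  move=> k0; have := dualB (bgrad_dual b_bregman (xz k0)) (z - x k) (w - x k).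
  by rewrite opprB addrA subrK /u /bregman_div; lra.
have ucvg : cvg (u k @[k --> \oo]).
  pose v k := fine (b z) - fine (b w) - (bregman_div b z (x k) - bregman_div b w (x k)).
  have vcvg : cvg (v k @[k --> \oo]).
    apply: is_cvgB; first exact: is_cvg_cst.
    by apply: is_cvgB; exact: divergence_cvg.
  apply/cvg_ex; exists (lim (v k @[k --> \oo])); apply: cvg_trans vcvg; apply: near_eq_cvg.
  by exists 1%N => // k /= /uE ->.
have sub (chi : nat -> nat) y : (forall k, (k <= chi k)%N) -> zone b y ->
    weak_cvg (x \o chi) y -> lim (u k @[k --> \oo]) = bgrad b y (z - w).
  move=> chik zy xy.
  have chioo : (chi k.+1) @[k --> \oo] --> \oo.
    move=> A [N _ NA]; exists N => // k /= Nk; apply: NA => /=.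
    exact: leq_trans (leq_trans Nk (leqnSn k)) (chik _).
  have h1 : u (chi k.+1) @[k --> \oo] --> lim (u k @[k --> \oo]) := cvg_comp _ _ chioo ucvg.
  have h2 : u (chi k.+1) @[k --> \oo] --> bgrad b y (z - w).
    apply: (bgrad_continuous (x := fun k => x (chi k.+1))) => //.
      by move=> k; apply: xz; exact: leq_trans (chik _).
    move=> l dl; have := xy l dl; rewrite -(cvg_shiftn 1) => h.
    by apply: cvg_trans h; apply: near_eq_cvg; apply: filterE => k; rewrite /= addn1.
  exact: (cvg_unique _ h1 h2).
have eq1 := sub _ _ phik zz xz'; have eq2 := sub _ _ psik zw xw.
have hz := bregman_div_ge_sqr b_bregman b_strong C_dom Cz Cw zw.
have hw := bregman_div_ge_sqr b_bregman b_strong C_dom Cw Cz zz.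
have dN := dualN (bgrad_dual b_bregman zz) (z - w); rewrite opprB in dN.
rewrite distrC in hw; move: hz hw; rewrite /bregman_div dN -eq1 -eq2 => hz hw.
have : mu * `|z - w| ^+ 2 <= 0 by lra.
rewrite pmulr_rle0// => n0; apply/eqP; rewrite -subr_eq0 -normr_eq0 -sqrf_eq0.
by rewrite eq_le n0 exprn_ge0.
Qed.

(** Strong convexity on [C] bounds [`|z - x k| ^ 2] by [2 / mu * B z (x k)]. *)
Let x_bounded : exists M : R, exists k1, forall k, (k1 <= k)%N -> `|x k| <= M.
Proof.
have [z zmin] := min_nonempty; have /(minimizersP f g_ninfty g_proper)[Cz _ _] := zmin.
have [j j0 Tz] := T_index Cz.
exists (`|z| + (2 / mu * bregman_div b z (x j) + 1)), j => k jk.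
have k0 : (0 < k)%N by exact: leq_trans jk.
have h1 := bregman_div_ge_sqr b_bregman b_strong C_dom Cz (xC k0) (xz k0).
have h2 := le_trans h1 (divergence_nonincreasing zmin j0 Tz (leqnn j) jk).
rewrite -(subKr z (x k)); apply: le_trans (ler_normB _ _) _; rewrite lerD2l.
set n := `|_ - _| in h2 *.
have n2 : n ^+ 2 <= 2 / mu * bregman_div b z (x j).
  rewrite -(ler_pM2l (x := mu / 2)) ?divr_gt0//; apply: le_trans h2 _.
  by rewrite le_eqVlt; apply/orP; left; apply/eqP; field; exact: lt0r_neq0.
have := sqr_ge0 (n - 1); move: n2; move: (2 / mu * _) => B; rewrite !expr2 => *; nra.
Qed.

Lemma weakly_converges : exists2 z, minimizers f g C z & weak_cvg x z.
Proof.
have [M [k1 xM]] := x_bounded.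
have extract (psi : nat -> nat) : (forall k, (k <= psi k)%N) ->
    exists phi z, (forall k, (k <= psi (phi k))%N) /\ weak_cvg (x \o (psi \o phi)) z.
  move=> psik.
  have [|phi [z [phik xphi]]] := 
    @weakly_convergent_subsequence _ _ (fun k => x (psi (k + k1)%N)) M reflexive.
    by move=> k; apply: xM; apply: leq_trans (psik _); exact: leq_addl.
  exists (fun k => (phi k + k1)%N), z; split => // k.
  by apply: leq_trans (psik _); apply: leq_trans (phik k) (leq_addr _ _).
have [phi [z [phik xphi]]] := extract id leqnn.
exists z; first exact: (cluster_minimizer (phi := phi)).
move=> l dl; apply: contrapT => ncv.
have [eps eps0 far] := not_cvg_far ncv.
have [psi psiP] := choice far.
have [chi [w [chik xchi]]] := extract psi (fun k => (psiP k).1).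
have zw := cluster_unique phik chik xphi xchi.
have /cvgrPdist_lt/(_ _ eps0)[N _ /(_ N (leqnn N))/=] := xchi _ dl.
by rewrite -zw ltNge (psiP _).2.
Qed.

End weak_convergence.
End convergence.

(** * Runs of the two algorithms along a slow telescope *)

Lemma max_upto_spec (P : nat -> bool) (k : nat) : P 0%N ->
  exists j, [/\ (j <= k)%N, P j & forall i, (i <= k)%N -> P i -> (i <= j)%N].
Proof.
move=> P0.
have ex : exists j, (j <= k)%N && P j by exists 0%N.
have ub j : (j <= k)%N && P j -> (j <= k)%N by case/andP.
have [j /andP[jk Pj] jmax] := ex_maxnP ex ub.
by exists j; split => // i ik Pi; apply: jmax; rewrite ik.
Qed.

(** [m k] is [M] plus the largest [j <= k] for which the bound on [lam (M + j)] already
holds at [k].  The bound at [j] persists once it holds, since the right hand side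
increases with [k], so that [m] is nondecreasing; it holds eventually, so that
[m] is unbounded. *)
Lemma slow_reindexing {R : realType} (lam : nat -> R) (a q : R) (M : nat) :
  0 < a -> 0 < q -> exists (m : nat -> nat) (k0 : nat),
  [/\ (0 < k0)%N, forall k, (M <= m k)%N /\ (m k <= m k.+1)%N,
      forall j, exists k, (0 < k)%N /\ (j <= m k)%N &
      forall k, (k0 <= k)%N -> lam (m k) <= a * k%:R `^ q].
Proof.
move=> a0 q0.
(* [j = 0] is always admitted, so that the maximum exists for all [k] *)
pose P k j := (j == 0%N) || (lam (M + j)%N <= a * k%:R `^ q).
have P0 k : P k 0%N by [].
have Pmono k j : P k j -> P k.+1 j.
  rewrite /P => /orP[->//|h]; apply/orP; right; apply: le_trans h _.
  rewrite ler_pM2l//; apply: (ge0_ler_powR (ltW q0)); rewrite ?nnegrE ?ler_nat//.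
have [n nP] := choice (fun k => max_upto_spec k (P0 k)).
have large j : exists N, forall k, (N <= k)%N -> lam (M + j)%N <= a * k%:R `^ q.
  have [N hN] := powR_nat_unbounded (lam (M + j)%N / a) q0.
  by exists N => k /hN; rewrite ler_pdivrMr// mulrC.
have [N0 hN0] := large 0%N.
exists (fun k => (M + n k)%N), N0.+1; split=> //.
- move=> k; split; first exact: leq_addr.
  rewrite leq_add2l; have [nk Pn _] := nP k; have [_ _ h] := nP k.+1.
  by apply: h; [exact: leq_trans (leqnSn k)|exact: Pmono].
- move=> j; have [N hN] := large j.
  exists (maxn N j).+1; split => //; apply: leq_trans (leq_addl M _).
  have [_ _ h] := nP (maxn N j).+1; apply: h; first by rewrite ltnW// ltnS leq_maxr.
  by rewrite /P hN ?orbT// ltnW// ltnS leq_maxl.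
- move=> k k0; have [_ + _] := nP k; rewrite /P => /orP[/eqP ->|//].
  by apply: hN0; exact: ltnW.
Qed.

Section telescopes.
Context {R : realType} {X : completeNormedModType R}.
Variables (b : X -> \bar R) (f : X -> R^o) (g : X -> \bar R) (C : set X) (mu : R).
Hypothesis b_bregman : semi_bregman b.
Hypothesis C_dom : C `<=` dom b.
Hypothesis f_convex : convex_function (dom b : set (convex_lmodType X)) f.
Hypothesis f_gateaux : forall y, zone b y -> gateaux_differentiable f y.
Hypothesis g_ninfty : forall x, C x -> (-oo < g x)%E.
Hypothesis g_convex : econvex_on C g.
Hypothesis g_lsc : lsc_on C g.
Hypothesis b_strong : strongly_convex_on b C mu.

Let mu0 : 0 < mu. Proof. by have [] := b_strong. Qed.
Let strong_sub S : S `<=` C -> strongly_convex_on b S mu.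
Proof.
move=> SC; have [_ [gau h]] := b_strong; split=> //; split=> // x y t Sx Sy.
by apply: h; exact: SC.
Qed.

Let Lip (D : set X) := smallest_lipschitz f (D `&` zone b).

(** Only the ratio of the two parameters matters, so that the parameters of a
telescope may be replaced by a common one. *)
Lemma prox_ratio (L1 mu1 L2 mu2 : R) S y : L1 / mu1 = L2 / mu2 ->
  prox b f g L1 mu1 S y = prox b f g L2 mu2 S y.
Proof. by move=> E; rewrite /prox /Q E. Qed.

Section chosen_telescope.
Variable T : nat -> set X.
Hypothesis TA2 : assumption_A2 b g C T (fun=> mu).
Hypothesis TA3 : assumption_A3 b f T.
Hypothesis TA4 : assumption_A4 b f g T (fun=> mu).

Lemma telescope_subset j k : (0 < j)%N -> (j <= k)%N -> T j `<=` T k.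
Proof.
move=> j0; elim: k => [|k IH]; first by rewrite leqn0 => /eqP j00; rewrite j00 in j0.
rewrite leq_eqVlt => /predU1P[->//|]; rewrite ltnS => jk.
apply: subset_trans (IH jk) _.
by have [/(_ k (leq_trans j0 jk))[[]]] := TA2.
Qed.

Let TC k : (0 < k)%N -> T k `<=` C.
Proof. by move=> k0; have [/(_ k k0)[_ []]] := TA2. Qed.

Let T_closed k : (0 < k)%N -> closed (T k).
Proof. by move=> k0; have [/(_ k k0)[[]]] := TA2. Qed.

Let T_convex k : (0 < k)%N -> convex_set (T k : set (convex_lmodType X)).
Proof. by move=> k0; have [/(_ k k0)[[]]] := TA2. Qed.

Let T_proper k : (0 < k)%N -> exists2 z, T k z & (g z < +oo)%E.
Proof.
move=> k0; have [_ [_ [z Tz gz]]] := TA2; exists z => //.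
exact: (telescope_subset (ltn0Sn 0) k0).
Qed.

Lemma telescope_lipschitz k : (0 < k)%N ->
  0 <= Lip (T k) /\ gradient_lipschitz f (T k `&` zone b) (Lip (T k)).
Proof.
by move=> k0; have [K K0 TK] := TA3 k0; have [] := lipschitz_smallest K0 TK.
Qed.

Lemma telescope_lipschitz_incr j k : (0 < j)%N -> (j <= k)%N -> Lip (T j) <= Lip (T k).
Proof.
move=> j0 jk; have [K K0 TK] := TA3 (leq_trans j0 jk).
apply: smallest_lipschitzS K0 TK => y [Ty zy]; split => //.
exact: telescope_subset Ty.
Qed.

Lemma backtracking_test_of_lipschitz k K y : (0 < k)%N -> 0 < K -> Lip (T k) <= K ->
  (T k `&` zone b) y -> backtracking_test b f g C T (fun=> mu) k K y.
Proof.
move=> k0 K0 LK [Ty zy]; have [L0 fL] := telescope_lipschitz k0.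
exact: (prox_descent b_bregman C_dom f_gateaux g_ninfty g_convex g_lsc (T_closed k0)
  (T_convex k0) (TC k0) (strong_sub (TC k0)) (T_proper k0) K0 mu0 zy Ty
  (TA4 K0 k0 (conj Ty zy)).2 erefl L0 fL LK).
Qed.

Section run_properties.
Variables (L : nat -> R) (x : nat -> X).
Hypothesis x1 : (T 1%N `&` zone b) (x 1%N).
Hypothesis L_pos : forall k, (0 < k)%N -> 0 < L k.
Hypothesis x_step : forall k, (0 < k)%N -> x k.+1 = prox b f g (L k.+1) mu (T k.+1) (x k).

Lemma run_in_telescope k : (0 < k)%N -> (T k `&` zone b) (x k).
Proof.
case: k => // k _; elim: k => [//|k [Tx zx]]; rewrite x_step//.
by apply: TA4; rewrite ?L_pos//; split => //; exact: telescope_subset Tx.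
Qed.

Let Tx_next k : (0 < k)%N -> (T k.+1 `&` zone b) (x k).
Proof.
by move=> k0; have [Tx zx] := run_in_telescope k0; split => //; exact: telescope_subset Tx.
Qed.

Lemma run_finite k : (0 < k)%N -> (g (x k.+1) < +oo)%E.
Proof.
move=> k0; rewrite x_step//; have [Tx zx] := Tx_next k0.
exact: (prox_finite b_bregman C_dom f_gateaux g_ninfty g_convex g_lsc (T_closed (ltn0Sn k))
  (T_convex (ltn0Sn k)) (TC (ltn0Sn k)) (strong_sub (TC (ltn0Sn k))) (T_proper (ltn0Sn k))
  (L_pos (ltn0Sn k)) mu0 zx).
Qed.

Lemma run_decrease k z : (0 < k)%N ->
  backtracking_test b f g C T (fun=> mu) k.+1 (L k.+1) (x k) ->
  T k.+1 z -> (g z < +oo)%E ->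
  real_objective f g (x k.+1) + L k.+1 / mu * bregman_div b z (x k.+1) <=
  real_objective f g z + L k.+1 / mu * bregman_div b z (x k).
Proof.
move=> k0 test Tz gz; rewrite x_step//; have [Tx zx] := Tx_next k0.
exact: (prox_sufficient_decrease b_bregman C_dom f_convex f_gateaux g_ninfty g_convex g_lsc
  (T_closed (ltn0Sn k)) (T_convex (ltn0Sn k)) (TC (ltn0Sn k)) (strong_sub (TC (ltn0Sn k)))
  (T_proper (ltn0Sn k)) (L_pos (ltn0Sn k)) mu0 zx
  (TA4 (L_pos (ltn0Sn k)) (ltn0Sn k) (Tx_next k0)).2 Tz gz test).
Qed.

End run_properties.

Let start : exists x1, (T 1%N `&` zone b) x1.
Proof. by have [/(_ 1%N isT)[[_ _ [x [y [Tx _ _]]] _] _] _] := TA2; exists x. Qed.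

Variables (alpha q : R) (k0 : nat).
Hypothesis alpha0 : 0 < alpha.
Hypothesis q0 : 0 < q.
Hypothesis k00 : (0 < k0)%N.
Hypothesis Lip_growth : forall k, (k0 <= k)%N -> 2 * Lip (T k) <= alpha * k%:R `^ q.

(** What both step size rules provide and the convergence analysis uses. *)
Definition controlled_run (L : nat -> R) (x : nat -> X) : Prop :=
  [/\ (T 1%N `&` zone b) (x 1%N),
      forall k, (0 < k)%N -> 0 < L k /\ L k <= L k.+1,
      forall k, (0 < k)%N -> x k.+1 = prox b f g (L k.+1) mu (T k.+1) (x k),
      forall k, (0 < k)%N -> backtracking_test b f g C T (fun=> mu) k.+1 (L k.+1) (x k) &
      forall k, (k0 < k)%N -> L k <= alpha * k%:R `^ q].

(** With [L k = alpha * (max k k0) ^ q]: for [k < k0] the Lipschitz constant at [k] is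
at most the one at [k0]. *)
Lemma lipschitz_controlled_run : exists L x,
  lipschitz_run b f g T (fun=> mu) L x /\ controlled_run L x.
Proof.
have [x1 Tx1] := start.
pose L k := alpha * (maxn k k0)%:R `^ q : R.
have L_pos k : 0 < L k by rewrite mulr_gt0// powR_gt0// ltr0n leq_max k00 orbT.
have L_incr k : L k <= L k.+1.
  rewrite ler_pM2l//; apply: (ge0_ler_powR (ltW q0)); rewrite ?nnegrE//.
  by rewrite ler_nat geq_max !leq_max leqnSn leqnn orbT.
have LipL k : (0 < k)%N -> Lip (T k) <= L k.
  move=> k_gt0; have kmax : (k <= maxn k k0)%N by rewrite leq_maxl.
  apply: le_trans (telescope_lipschitz_incr k_gt0 kmax) _.
  apply: le_trans (Lip_growth (leq_maxr k k0)).
  have [] := telescope_lipschitz (leq_trans k_gt0 kmax); lra.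
(* the state at [n] is the iterate of index [n.+1] *)
pose st := fix st n := if n is n'.+1 then prox b f g (L n'.+2) mu (T n'.+2) (st n') else x1.
pose x k := st k.-1.
have xS k : (0 < k)%N -> x k.+1 = prox b f g (L k.+1) mu (T k.+1) (x k) by case: k.
have xT := run_in_telescope (Tx1 : (T 1%N `&` zone b) (x 1%N)) (fun k _ => L_pos k) xS.
exists L, x; split.
  split => //; first exact: LipL.
  move=> k k1; have k0' : (0 < k)%N by exact: ltnW.
  split; first by rewrite ge_max LipL// andbT; case: k {k1} k0'.
  by case: k k1 {k0'} => // k k_gt0; exact: xS.
split=> //.
  move=> k k_gt0; apply: backtracking_test_of_lipschitz => //; first exact: LipL.
  by have [Tx zx] := xT k k_gt0; split => //; exact: telescope_subset Tx.
by move=> k k0k; rewrite /L (maxn_idPl (ltnW k0k)).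
Qed.

Hypothesis Lip_start : (forall k, (0 < k)%N -> T k = C) \/ 0 < Lip (T 1%N).

(** With factor 2, an increase of [L] at step [k] means that half of the new value
failed the test, so it is below the Lipschitz constant at [k]. *)
Lemma backtracking_controlled_run : exists eta L x,
  backtracking_run b f g C T (fun=> mu) eta L x /\ controlled_run L x.
Proof.
have [x1 Tx1] := start.
pose test k K y := backtracking_test b f g C T (fun=> mu) k K y.
have [L1 [L10 L1start L1small]] : exists L1 : R, [/\ 0 < L1,
    (forall k, (0 < k)%N -> T k = C) \/ L1 <= 2 * Lip (T 1%N) &
    forall k, (k0 < k)%N -> L1 <= alpha * k%:R `^ q].
  case: Lip_start => [TE|Lip1].
    exists alpha; split => //; first by left.
    move=> k k0k; rewrite ler_pMr//; apply: le_trans (_ : 1 `^ q <= _); first by rewrite powR1.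
    by apply: (ge0_ler_powR (ltW q0)); rewrite ?nnegrE//= ler1n (leq_ltn_trans (leq0n _) k0k).
  exists (2 * Lip (T 1%N)); split; [by rewrite mulr_gt0|by right|].
  move=> k k0k; apply: le_trans (Lip_growth (ltnW k0k)); rewrite ler_pM2l//.
  by apply: telescope_lipschitz_incr => //; exact: leq_trans k0k.
pose good k K y (i : nat) := test k (2 ^+ i * K) y /\
  forall j, (j < i)%N -> ~ test k (2 ^+ j * K) y.
have goodP k K y : (0 < k)%N -> 0 < K -> (T k `&` zone b) y -> exists i, good k K y i.
  move=> k_gt0 K0 Ty.
  have ex : exists i, `[< test k (2 ^+ i * K) y >].
    exists (Num.truncn (Lip (T k) / K)).+1; apply/asboolP.
    apply: backtracking_test_of_lipschitz => //.
      by rewrite mulr_gt0// exprn_gt0.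
    rewrite -ler_pdivrMr//; apply: le_trans (ltW (truncnS_gt _)) _.
    by rewrite -natrX ler_nat ltnW// ltn_expl.
  have [i /asboolP ti imin] := ex_minnP ex; exists i; split=> // j ji tj.
  by have := imin j (asboolT tj); rewrite leqNgt ji.
pose step n (s : X * R) := let i := get [set i | good n.+2 s.2 s.1 i] in
  (prox b f g (2 ^+ i * s.2) mu (T n.+2) s.1, 2 ^+ i * s.2).
(* the state at [n] holds the iterate and the weight of index [n.+1] *)
pose st := fix st n : X * R := if n is n'.+1 then step n' (st n') else (x1, L1).
pose x k := (st k.-1).1; pose L k := (st k.-1).2.
have inv n : (T n.+1 `&` zone b) (st n).1 /\ 0 < (st n).2.
  elim: n => [//|n [[Tx zx] Kn]] /=.
  have K0 i : 0 < 2 ^+ i * (st n).2 by rewrite mulr_gt0// exprn_gt0.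
  by split => //; apply: TA4 => //; split => //; exact: telescope_subset Tx.
have Tx k : (0 < k)%N -> (T k.+1 `&` zone b) (x k).
  case: k => // k _; have [[Tx zx] _] := inv k.
  by split => //; exact: telescope_subset Tx.
have L_pos k : (0 < k)%N -> 0 < L k by case: k => // k _; have [] := inv k.
have stepP k : (0 < k)%N -> exists i, [/\ good k.+1 (L k) (x k) i, L k.+1 = 2 ^+ i * L k &
    x k.+1 = prox b f g (L k.+1) mu (T k.+1) (x k)].
  case: k => // k _; exists (get [set i | good k.+2 (st k).2 (st k).1 i]); split => //.
  apply: (@getPex _ [set i | good k.+2 (st k).2 (st k).1 i]).
  by apply: goodP => //; [exact: (L_pos k.+1)|exact: (Tx k.+1)].
have L_bound k : (0 < k)%N -> L k <= Num.max L1 (2 * Lip (T k)).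
  elim: k => // -[_ _|k /(_ isT) IH _]; first by rewrite /L /= le_max lexx.
  have [i [[_ imin] -> _]] := stepP k.+1 isT.
  case: i imin => [_|i imin].
    rewrite expr0 mul1r; apply: le_trans IH _; rewrite ge_max !le_max lexx/=.
    by rewrite ler_pM2l// telescope_lipschitz_incr// orbT.
  rewrite le_max exprS -mulrA ler_pM2l//; apply/orP; right.
  rewrite leNgt; apply/negP => h; apply: (imin i (ltnSn i)).
  apply: backtracking_test_of_lipschitz => //; [|exact: ltW|exact: (Tx k.+1)].
  by rewrite mulr_gt0 ?exprn_gt0// L_pos.
exists 2, L, x; split.
  split => //; first by rewrite ltr1n.
  case=> [|[|k]]// _; have [i [[ti imin] Li xi]] := stepP k.+1 isT.
  by split => //; exists i; split => //; rewrite -?Li// -Li.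
split => //.
- move=> k k_gt0; split; first exact: L_pos.
  have [i [_ -> _]] := stepP k k_gt0.
  by rewrite ler_peMl ?(ltW (L_pos _ _))// exprn_ege1// ler1n.
- by move=> k /stepP[i []].
- by move=> k /stepP[i [[+ _] ->]].
- move=> k k0k; have k_gt0 : (0 < k)%N by exact: leq_trans k0k.
  apply: le_trans (L_bound k k_gt0) _; rewrite ge_max L1small//=.
  exact: Lip_growth (ltnW k0k).
Qed.

End chosen_telescope.
End telescopes.

(** * Existence of slow telescopes *)

(** [S] is the given telescope, and the constructed one has the constant parameter
[mu]. *)
Section telescope_existence.
Context {R : realType} {X : completeNormedModType R}.
Variables (b : X -> \bar R) (f : X -> R^o) (g : X -> \bar R) (C : set X) (mu : R).
Variables (S : nat -> set X) (mu_ : nat -> R).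
Hypothesis b_bregman : semi_bregman b.
Hypothesis C_dom : C `<=` dom b.
Hypothesis C_closed : closed C.
Hypothesis C_convex : convex_set (C : set (convex_lmodType X)).
Hypothesis f_gateaux : forall y, zone b y -> gateaux_differentiable f y.
Hypothesis g_ninfty : forall x, C x -> (-oo < g x)%E.
Hypothesis g_proper : exists2 x, C x & (g x < +oo)%E.
Hypothesis g_convex : econvex_on C g.
Hypothesis g_lsc : lsc_on C g.
Hypothesis b_strong : strongly_convex_on b C mu.
Hypothesis SA2 : assumption_A2 b g C S mu_.
Hypothesis SA3 : assumption_A3 b f S.
Hypothesis SA4 : assumption_A4 b f g S mu_.

Let Lip (D : set X) := smallest_lipschitz f (D `&` zone b).

Let mu0 : 0 < mu. Proof. by have [] := b_strong. Qed.

Let S_incr j k : (0 < j)%N -> (j <= k)%N -> S j `<=` S k.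
Proof.
move=> j0; elim: k => [|k IH]; first by rewrite leqn0 => /eqP j00; rewrite j00 in j0.
rewrite leq_eqVlt => /predU1P[->//|]; rewrite ltnS => jk.
apply: subset_trans (IH jk) _.
by have [/(_ k (leq_trans j0 jk))[[]]] := SA2.
Qed.

Let S_cover x : C x -> exists2 j, (0 < j)%N & S j x.
Proof. by have [_ [<- _]] := SA2 => -[j /= j0 Sj]; exists j. Qed.

Let S_sub j : (0 < j)%N -> S j `<=` C.
Proof. by move=> j0; have [/(_ j j0)[_ []]] := SA2. Qed.

Let strong_sub D : D `<=` C -> strongly_convex_on b D mu.
Proof.
move=> DC; have [_ [gau h]] := b_strong; split=> //; split=> // x y t Dx Dy.
by apply: h; exact: DC.
Qed.

Let S_lip j : (0 < j)%N -> 0 <= Lip (S j) /\ gradient_lipschitz f (S j `&` zone b) (Lip (S j)).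
Proof. by move=> /SA3[K K0 SK]; have [] := lipschitz_smallest K0 SK. Qed.

Let S_prox K j y : 0 < K -> (0 < j)%N -> (S j `&` zone b) y ->
  (S j `&` zone b) (prox b f g K mu (S j) y).
Proof.
move=> K0 j0 Sy.
have mj0 : 0 < mu_ j by have [/(_ j j0)[_ [_ [] ]]] := SA2.
rewrite (@prox_ratio _ _ b f g K mu (K * mu_ j / mu) (mu_ j)).
  by apply: SA4; rewrite // divr_gt0// mulr_gt0.
by field; rewrite !lt0r_neq0.
Qed.

(** Membership of the proximal points in the zone is transported by [prox_ratio]. *)
Let reindexed_telescope (m : nat -> nat) (T := fun k => S (m k)) :
  (forall k, (0 < m k)%N /\ (m k <= m k.+1)%N) -> (forall j, exists k, (0 < k)%N /\ (j <= m k)%N) ->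
  [/\ assumption_A2 b g C T (fun=> mu), assumption_A3 b f T & assumption_A4 b f g T (fun=> mu)].
Proof.
move=> mP mlarge; split.
- split; last split.
  + move=> k k0; have [mk0 mk1] := mP k; have [/(_ _ mk0)[[cS vS pS _] [SC _ _]] _] := SA2.
    split; first by split => //; exact: S_incr.
    by split => //; exact: strong_sub.
  + apply/seteqP; split=> [x [k /= k0]|x /S_cover[j j0 Sj]].
      by apply: S_sub; have [] := mP k.
    by have [k [k0 jk]] := mlarge j; exists k => //; exact: S_incr jk _ Sj.
  + have [_ [_ [z Sz gz]]] := SA2; exists z => //.
    by apply: (S_incr (ltn0Sn 0) _ Sz); have [] := mP 1%N.
- by move=> k k0; apply: SA3; have [] := mP k.
- by move=> K k y K0 k0; apply: S_prox => //; have [] := mP k.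
Qed.

(** A proximal point over [C] belongs to some [S j], and by uniqueness it is the
proximal point over this [S j], which lies in the zone. *)
Let constant_telescope (T := fun _ : nat => C) :
  (forall j, (0 < j)%N -> Lip (S j) = 0) ->
  [/\ assumption_A2 b g C T (fun=> mu), assumption_A3 b f T & assumption_A4 b f g T (fun=> mu)] /\
  Lip C = 0.
Proof.
move=> Lip0.
have CL : gradient_lipschitz f (C `&` zone b) 0.
  move=> x y [/S_cover[i i0 Si] zx] [/S_cover[j j0 Sj] zy].
  have ij0 : (0 < maxn i j)%N by rewrite leq_max i0.
  have [_] := S_lip ij0; rewrite Lip0//; apply; split => //.
    by apply: (S_incr i0 _ Si); exact: leq_maxl.
  by apply: (S_incr j0 _ Sj); exact: leq_maxr.
split; last first.
  have [h1 _ h2] := lipschitz_smallest (lexx 0) CL.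
  by apply/eqP; rewrite eq_le h2 h1.
split.
- split; last split.
  + move=> k k0; split; last by split.
    split => //; have [/(_ 1%N isT)[[_ _ [x [y [[Sx zx] [Sy zy] xy]]] _] [SC _ _]] _] := SA2.
    by exists x, y; split => //; split => //; exact: SC.
  + by apply/seteqP; split=> [x []//|x Cx]; exists 1%N.
  + by have [z Cz gz] := g_proper; exists z.
- by move=> k k0; exists 0.
- move=> K k y K0 k0 [Cy zy].
  have [Cp pmin] := prox_minimizes b_bregman C_dom f_gateaux g_ninfty g_convex g_lsc
    C_closed C_convex (fun _ h => h) b_strong g_proper K0 mu0 zy.
  split => //; have [i i0 Si] := S_cover Cp; have [j j0 Sj] := S_cover Cy.
  have ij0 : (0 < maxn i j)%N by rewrite leq_max i0.
  have Sp : S (maxn i j) (prox b f g K mu C y) by apply: (S_incr i0 _ Si); exact: leq_maxl.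
  have Sy : S (maxn i j) y by apply: (S_incr j0 _ Sj); exact: leq_maxr.
  have [/(_ _ ij0)[[cS vS _ _] [SC _ _]] [_ [z0 Sz0 gz0]]] := SA2.
  have gS : exists2 z, S (maxn i j) z & (g z < +oo)%E.
    by exists z0 => //; exact: (S_incr (ltn0Sn 0) ij0).
  rewrite (prox_unique b_bregman C_dom f_gateaux g_ninfty g_convex g_lsc cS vS SC
    (strong_sub SC) gS K0 mu0 zy Sp).
    by have [] := S_prox K0 ij0 (conj Sy zy).
  by move=> w Sw; apply: pmin; exact: SC.
Qed.

Lemma telescope_exists (z : X) (alpha q : R) : C z -> 0 < alpha -> 0 < q ->
  exists (T : nat -> set X) (k0 : nat),
  [/\ assumption_A2 b g C T (fun=> mu), assumption_A3 b f T & assumption_A4 b f g T (fun=> mu)] /\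
  [/\ (0 < k0)%N, T 1%N z,
      forall k, (k0 <= k)%N -> 2 * Lip (T k) <= alpha * k%:R `^ q &
      (forall k, (0 < k)%N -> T k = C) \/ 0 < Lip (T 1%N)].
Proof.
move=> Cz alpha0 q0.
(* is the gradient of [f] nonconstant on the part of some [S j] in the zone? *)
have [[j [j0 Lj]]|nLip] := pselect (exists j, (0 < j)%N /\ 0 < Lip (S j)); last first.
  have [|TA LC] := constant_telescope.
    move=> j j0; apply/eqP; rewrite eq_le (S_lip j0).1 andbT leNgt.
    by apply/negP => Lj; apply: nLip; exists j.
  exists (fun=> C), 1%N; split => //; split => //; last by left.
  by move=> k k1; rewrite LC mulr0 mulr_ge0 ?powR_ge0// ltW.
have [i i0 Si] := S_cover Cz.
have [m [k0 [k00 mP mlarge mLip]]] := slow_reindexing (fun n => 2 * Lip (S n)) (maxn i j) alpha0 q0.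
have im k : (i <= m k)%N by apply: leq_trans (mP k).1; exact: leq_maxl.
have jm k : (j <= m k)%N by apply: leq_trans (mP k).1; exact: leq_maxr.
exists (fun k => S (m k)), k0; split.
  by apply: reindexed_telescope => // k; split; [exact: leq_trans (im k)|exact: (mP k).2].
split => //; first exact: (S_incr i0 (im 1%N)).
right; apply: lt_le_trans Lj _.
have [K K0 SK] := SA3 (leq_trans j0 (jm 1%N)).
by apply: smallest_lipschitzS K0 SK => y [Sy zy]; split => //; exact: S_incr (jm 1%N) _ Sy.
Qed.

End telescope_existence.

(** * Uniform convexity on the zone implies the growth condition *)

Section uniform_convexity.
Context {R : realType} {X : completeNormedModType R}.
Variables (b : X -> \bar R).
Hypothesis b_bregman : semi_bregman b.
Variable psi : R -> \bar R.
Hypothesis b_unif : rel_uniformly_convex b (zone b) (zone b) psi.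

Let br (x : X) : R := fine (b x).
(** The gauge may take the value [+oo]; this is a finite positive minorant of it. *)
Let capped_gauge (t : R) : R := fine (Order.min (psi t) 1%E).

Let capped_gaugeP t : 0 < t -> 0 < capped_gauge t /\ ((capped_gauge t)%:E <= psi t)%E.
Proof.
move=> t0; have [[_ /(_ t t0) psi_t] _] := b_unif; rewrite /capped_gauge; move: psi_t.
case: (psi t) => [r r0| _|//]; last by rewrite minye/= ltr01 leey.
by rewrite -EFin_min /= lee_fin ge_min lexx lt_min ltr01 andbT; rewrite lte_fin in r0.
Qed.

Let midpoint_gap u v : zone b u -> zone b v -> u != v ->
  capped_gauge `|u - v| / 2 <= br u + br v - 2 * br (2^-1 *: u + (1 - 2^-1) *: v).
Proof.
move=> zu zv uv; have nuv : 0 < `|u - v| by rewrite normr_gt0 subr_eq0.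
have half : 0 < (2^-1 : R) < 1 by rewrite invr_gt0 ltr0Sn invf_lt1// ltr1n.
have [k0 kpsi] := capped_gaugeP nuv; have [_ /(_ u v _ zu zv half) h] := b_unif.
have [[bN _ _] _] := b_bregman.
have [] := @fine_convex _ (b u) (b v) (b (2^-1 *: u + (1 - 2^-1) *: v)) 2^-1
  (2^-1 * (1 - 2^-1) * capped_gauge `|u - v|)
  (dom_fin b_bregman (zone_dom zu)) (dom_fin b_bregman (zone_dom zv)) (bN _) _.
  apply: le_trans h; apply: leeD => //; rewrite EFinM; apply: lee_pmul => //.
    by rewrite lee_fin; lra.
  by rewrite lee_fin ltW.
rewrite -/br => _; rewrite -/(br _) -/(br u) -/(br v); lra.
Qed.

(** The constants are those which [second_diff_gauge] provides; growth at infinity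
comes from distances at least 1. *)
Definition large_gauge (t : R) : R :=
  if t < 1 then capped_gauge (t / 2) / 2 else t * (capped_gauge 2^-1 / 4).

Lemma large_gauge_gt0 t : 0 < t -> 0 < large_gauge t.
Proof.
move=> t0; rewrite /large_gauge; case: ifPn => _.
  by have [k0 _] := @capped_gaugeP (t / 2) ltac:(lra); rewrite divr_gt0.
by have [k0 _] := @capped_gaugeP 2^-1 ltac:(lra); rewrite mulr_gt0// divr_gt0.
Qed.

(** [b] is studied along the segment from [y], in the zone, to [x], in the domain;
all points but possibly [x] lie in the zone. *)
Section segment.
Variables (x y : X).
Hypothesis dx : dom b x.
Hypothesis zy : zone b y.
Hypothesis xy : x != y.

Let d := `|x - y|.
Let d0 : 0 < d. Proof. by rewrite normr_gt0 subr_eq0. Qed.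
Let pt (s : R) : X := s *: x + (1 - s) *: y.
Let phi (s : R) : R := br (pt s).

Let pt_conv a c t : t *: pt a + (1 - t) *: pt c = pt (t * a + (1 - t) * c).
Proof.
rewrite /pt !scalerDr !scalerA addrACA -!scalerDl; congr (_ *: _ + _ *: _).
by ring.
Qed.

Let pt_sub a c : pt a - pt c = (a - c) *: (x - y).
Proof.
have ptE s : pt s = y + s *: (x - y) by rewrite /pt scalerBl scale1r scalerBr addrCA.
by rewrite !ptE opprD addrACA subrr add0r -scalerBl.
Qed.

Let pt_dom s : 0 <= s <= 1 -> dom b (pt s).
Proof.
move=> /andP[s0]; rewrite le_eqVlt => /predU1P[->|s1].
  by rewrite /pt scale1r subrr scale0r addr0.
by apply: zone_dom; apply: (zone_segment b_bregman) => //; rewrite s0.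
Qed.

Let phi_convex a c t : 0 <= a <= 1 -> 0 <= c <= 1 -> 0 <= t <= 1 ->
  phi (t * a + (1 - t) * c) <= t * phi a + (1 - t) * phi c.
Proof.
move=> a01 c01 /andP[]; rewrite le_eqVlt => /predU1P[<- _|t0].
  by rewrite !mul0r subr0 !mul1r !add0r.
rewrite le_eqVlt => /predU1P[->|t1]; first by rewrite subrr !mul0r !mul1r !addr0.
rewrite /phi -pt_conv; have := dom_convex b_bregman (pt_dom a01) (pt_dom c01).
by move=> /(_ t); rewrite t0 t1 => /(_ isT)[].
Qed.

Let second_diff m s := phi (m + s) + phi (m - s) - 2 * phi m.

Let second_diff_small m s : 0 < s -> 0 <= m - s -> m + s < 1 ->
  capped_gauge (2 * s * d) / 2 <= second_diff m s.
Proof.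
move=> s0 ms0 ms1.
have z1 : zone b (pt (m + s)) by apply: (zone_segment b_bregman) => //; rewrite ms1 andbT; lra.
have z2 : zone b (pt (m - s)) by apply: (zone_segment b_bregman) => //; rewrite ms0/=; lra.
have E : pt (m + s) - pt (m - s) = (2 * s) *: (x - y).
  by rewrite pt_sub; congr (_ *: _); ring.
have nE : `|pt (m + s) - pt (m - s)| = 2 * s * d by rewrite E normrZ gtr0_norm// mulr_gt0.
have := midpoint_gap z1 z2; rewrite nE -subr_eq0 -normr_gt0 nE.
rewrite !mulr_gt0// => /(_ isT); rewrite pt_conv /second_diff /phi.
by have -> : 2^-1 * (m + s) + (1 - 2^-1) * (m - s) = m by field.
Qed.

Let second_diff_double m s :
  second_diff m (2 * s) = second_diff (m + s) s + second_diff (m - s) s + 2 * second_diff m s.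
Proof.
rewrite /second_diff.
have -> : m + 2 * s = m + s + s by ring.
have -> : m - 2 * s = m - s - s by ring.
by rewrite addrK subrK; ring.
Qed.

Let second_diff_iter n m s : 0 < s -> 0 <= m - 2 ^+ n * s -> m + 2 ^+ n * s < 1 ->
  4 ^+ n * (capped_gauge (2 * s * d) / 2) <= second_diff m (2 ^+ n * s).
Proof.
move=> s0; elim: n m => [|n IH] m; first by rewrite !expr0 !mul1r; exact: second_diff_small.
have p0 : 0 < 2 ^+ n * s by rewrite mulr_gt0// exprn_gt0.
rewrite !exprS -[2 * _ * s]mulrA -[4 * _ * _]mulrA => h1 h2; rewrite second_diff_double.
have := IH (m + 2 ^+ n * s); have := IH (m - 2 ^+ n * s); have := IH m.
move: p0 h1 h2; set u := 2 ^+ n * s => p0 h1 h2.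
move=> /(_ ltac:(lra) ltac:(lra)) i1 /(_ ltac:(lra) ltac:(lra)) i2 /(_ ltac:(lra) ltac:(lra)) i3.
lra.
Qed.

(** Passing to a smaller step avoids the endpoint [x], which may lie outside the zone. *)
Let second_diff_mono s s' : 0 < s' -> s' <= s -> s <= 2^-1 ->
  second_diff 2^-1 s' <= second_diff 2^-1 s.
Proof.
move=> s'0 ss s1; have s0 : 0 < s by exact: lt_le_trans ss.
pose t := (1 + s' / s) / 2.
have ts : t * s = (s + s') / 2 by rewrite /t; field; exact: lt0r_neq0.
have r0 : 0 <= s' / s by rewrite divr_ge0 ?(ltW s0) ?(ltW s'0).
have r1 : s' / s <= 1 by rewrite ler_pdivrMr// mul1r.
have t01 : 0 <= t <= 1 by rewrite /t; apply/andP; split; lra.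
have a01 : 0 <= 2^-1 + s <= 1 by apply/andP; split; lra.
have c01 : 0 <= 2^-1 - s <= 1 by apply/andP; split; lra.
have := phi_convex a01 c01 t01; have := phi_convex c01 a01 t01.
have -> : t * (2^-1 + s) + (1 - t) * (2^-1 - s) = 2^-1 + s'.
  have -> u : u * (2^-1 + s) + (1 - u) * (2^-1 - s) = 2^-1 - s + 2 * (u * s) by field.
  by rewrite ts; field.
have -> : t * (2^-1 - s) + (1 - t) * (2^-1 + s) = 2^-1 - s'.
  have -> u : u * (2^-1 - s) + (1 - u) * (2^-1 + s) = 2^-1 + s - 2 * (u * s) by field.
  by rewrite ts; field.
rewrite /second_diff; lra.
Qed.

Let second_diff_gauge : large_gauge d <= second_diff 2^-1 2^-1.
Proof.
rewrite /large_gauge; have [d1|d1] := ltP d 1.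
  have -> : d / 2 = 2 * 4^-1 * d by field.
  by apply: le_trans (second_diff_small _ _ _) (second_diff_mono _ _ _); lra.
(* [2 ^ n <= d < 2 ^ (n + 1)] *)
pose N := Num.truncn d; pose n := trunc_log 2 N.
have /andP[Nd dN] : N%:R <= d < N.+1%:R by apply: truncn_itv; exact: ltW.
have N0 : (0 < N)%N by rewrite truncn_gt0.
have /andP[nN Nn] : (2 ^ n <= N < 2 ^ n.+1)%N by apply: trunc_log_bounds.
have n1 : 2 ^+ n <= d by apply: le_trans Nd; rewrite -natrX ler_nat.
have n2 : d < 2 * 2 ^+ n by apply: lt_le_trans dN _; rewrite -exprS -natrX ler_nat.
(* points at parameters [m - s] and [m + s] are at distance 1/2, and [2 ^ n * s <= 1/4] *)
pose s := (4 * d)^-1.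
have s0 : 0 < s by rewrite invr_gt0 mulr_gt0.
have sd : 2 * s * d = 2^-1 by rewrite /s; field; exact: lt0r_neq0.
have ns : 2 ^+ n * s <= 4^-1.
  by rewrite /s invfM mulrCA ger_pMr// ler_pdivrMr// mul1r.
have ns0 : 0 < 2 ^+ n * s by rewrite mulr_gt0// exprn_gt0.
have := @second_diff_iter n 2^-1 s s0 ltac:(lra) ltac:(lra); rewrite sd => h.
apply: le_trans (second_diff_mono ns0 _ (lexx _)); last by lra.
apply: le_trans h; have [k0 _] := @capped_gaugeP 2^-1 ltac:(lra).
have -> : 4 ^+ n = 2 ^+ n * 2 ^+ n :> R by rewrite -exprMn; congr (_ ^+ n); ring.
have n1' : 1 <= 2 ^+ n :> R by rewrite exprn_ege1// ler1n.
have : d * capped_gauge 2^-1 <= (2 * 2 ^+ n * 2 ^+ n) * capped_gauge 2^-1.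
  rewrite ler_pM2r//; apply: le_trans (ltW n2) _.
  have p0 : 0 <= 2 * 2 ^+ n :> R by rewrite mulr_ge0// exprn_ge0.
  by have := ler_wpM2l p0 n1'; rewrite mulr1.
lra.
Qed.

(** The deviation of [phi] from its chord is concave and vanishes at the endpoints,
so its value at [t] is at least [2 * min t (1 - t)] times the one at the midpoint. *)
Lemma segment_gauge t : 0 < t < 1 ->
  br (t *: x + (1 - t) *: y) + t * (1 - t) * large_gauge d <= t * br x + (1 - t) * br y.
Proof.
move=> /andP[t0 t1].
have gap := second_diff_gauge; rewrite /second_diff in gap.
have lg0 := large_gauge_gt0 d0.
have -> : br x = phi 1 by rewrite /phi /pt scale1r subrr scale0r addr0.
have -> : br y = phi 0 by rewrite /phi /pt scale0r add0r subr0 scale1r.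
rewrite -/(pt t) -/(phi t).
have hh : 2^-1 + 2^-1 = 1 :> R by field.
rewrite hh subrr in gap.
have i0 : 0 <= (0 : R) <= 1 by rewrite lexx ler01.
have i1 : 0 <= (1 : R) <= 1 by rewrite lexx ler01.
have ih : 0 <= (2^-1 : R) <= 1 by apply/andP; split; lra.
have [t2|t2] := leP t 2^-1.
  have := @phi_convex 2^-1 0 (2 * t) ih i0 ltac:(apply/andP; split; lra).
  rewrite mulr0 addr0 mulrAC mulfV// mul1r => h.
  have h1 : 0 <= t * (phi 1 + phi 0 - 2 * phi 2^-1 - large_gauge d) by apply: mulr_ge0; lra.
  have h2 : 0 <= large_gauge d * (t * t) by rewrite mulr_ge0 ?mulr_ge0 ?(ltW t0) ?(ltW lg0).
  lra.
have := @phi_convex 2^-1 1 (2 * (1 - t)) ih i1 ltac:(apply/andP; split; lra).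
have -> : 2 * (1 - t) * 2^-1 + (1 - 2 * (1 - t)) * 1 = t by field.
move=> h.
have h1 : 0 <= (1 - t) * (phi 1 + phi 0 - 2 * phi 2^-1 - large_gauge d) by apply: mulr_ge0; lra.
have h2 : 0 <= large_gauge d * ((1 - t) * (1 - t)).
  by rewrite mulr_ge0 ?mulr_ge0 ?(ltW lg0)//; lra.
lra.
Qed.

End segment.

(** The radius is 0, and the gauge is the same for all points of [C]. *)
Lemma uniformly_convex_growth C : C `<=` dom b -> growth_condition b C.
Proof.
move=> Cd x Cx; exists 0; split=> //.
  by have [[_ [y zy] _] _] := b_bregman; exists y; split => //=.
pose psi' (t : R) := (if 0 < t then large_gauge t else 0)%:E.
exists psi'; split; last first.
  apply/cvgeyPge => A; near=> t; rewrite /psi'.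
  have k0 : 0 < capped_gauge 2^-1 by have [] := @capped_gaugeP 2^-1 ltac:(lra).
  have t1 : 1 <= t by near: t; exact: nbhs_pinfty_ge.
  rewrite (lt_le_trans ltr01 t1) /large_gauge ltNge t1 /= lee_fin.
  by rewrite -ler_pdivrMr ?divr_gt0//; near: t; exact: nbhs_pinfty_ge.
split.
  split=> t t0; rewrite /psi' ?lee_fin ?lte_fin; first by case: ifPn => // /large_gauge_gt0/ltW.
  by rewrite t0 large_gauge_gt0.
move=> _ y lam -> [zy _] lam01.
have [dx dy] := (Cd _ Cx, zone_dom zy).
have [dz hz] := dom_convex b_bregman dx dy lam01.
rewrite (domP b_bregman dx) (domP b_bregman dy) (domP b_bregman dz) -!EFinM -!EFinD lee_fin /psi'.
have [->|xy] := eqVneq x y.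
  have -> : lam *: y + (1 - lam) *: y = y.
    by rewrite -scalerDl (_ : lam + (1 - lam) = 1) ?scale1r//; ring.
  by rewrite subrr normr0 ltxx mulr0 addr0; lra.
by rewrite normr_gt0 subr_eq0 xy; exact: segment_gauge.
Unshelve. all: by end_near. Qed.

End uniform_convexity.

(** * The main theorem *)

Lemma operator_norm_ge0 {R : realType} {X : completeNormedModType R} (A : X -> X -> R^o) :
  0 <= operator_norm A.
Proof.
have nonneg (E : set R) : (forall r, E r -> 0 <= r) -> 0 <= sup E.
  move=> E0; have [hE|nE] := pselect (has_sup E); last by rewrite sup_out.
  have [[r Er] ub] := hE; apply: le_trans (E0 _ Er) _; exact: sup_upper_bound.
by apply: (nonneg) => _ [v _ <-]; apply: (nonneg) => _ [w _ <-].
Qed.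

Theorem corollary6p2 (R : realType) (X : completeNormedModType R)
    (b : X -> \bar R) (f : X -> R^o) (g : X -> \bar R) (C : set X)
    (S : nat -> set X) (mu_ : nat -> R)
    (f'' : X -> X -> X -> R^o) (mu : R)
  (X_nontrivial : exists x : X, x != 0)
  (X_reflexive : reflexive_space (X := X))
  (b_bregman : semi_bregman b)
  (C_dom : C `<=` dom b)
  (C_nonempty : C !=set0)
  (C_closed : closed C)
  (C_convex : convex_set (C : set (convex_lmodType X)))
  (C_points : more_than_one_point C)
  (C_zone : C `&` zone b !=set0)
  (f_convex : convex_function (dom b : set (convex_lmodType X)) f)
  (f_gateaux : forall y, zone b y -> gateaux_differentiable f y)
  (f_lsc : lsc_on C (fun x => (f x)%:E))
  (g_ninfty : forall x, C x -> (-oo < g x)%E)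
  (g_proper : exists2 x, C x & (g x < +oo)%E)
  (g_convex : econvex_on C g)
  (g_lsc : lsc_on C g)
  (A1 : minimizers f g C !=set0 /\ minimizers f g C `<=` zone b)
  (A2 : assumption_A2 b g C S mu_)
  (A3 : assumption_A3 b f S)
  (A4 : assumption_A4 b f g S mu_)
  (f''_exists : forall y, (C `&` zone b) y -> is_second_derivative f y (f'' y))
  (f''_bounded : bounded_on_bounded_subsets f'' (C `&` zone b))
  (f''_unif : unif_continuous_on_bounded_subsets f'' (C `&` zone b))
  (b_strong : strongly_convex_on b C mu) :
  (forall rule : stepsize_rule,
    (forall q : R, 0 < q < 1 -> exists x : nat -> X,
      [/\ constructible b f g C rule x,
          converges_at_rate f g C q x &
          growth_condition b C -> weak_to_weakstar_seq_continuous b ->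
            exists2 z, minimizers f g C z & weak_cvg x z]) /\
    (forall (xmin : X) (q : R) (y0 : X) (alpha : R),
      minimizers f g C xmin -> 0 < q < 1 -> (C `&` zone b) y0 ->
      operator_norm (f'' y0) < alpha ->
      exists (x : nat -> X) (k0 : nat),
      [/\ constructible b f g C rule x,
          converges_at_rate f g C q x,
          (0 < k0)%N /\ forall k, (k0 <= k)%N ->
            (objective f g C (x k.+1) - objective f g C xmin <=
              (k.+1%:R / (k.+1%:R - k0%:R)
                 * (alpha / (mu * k.+1%:R `^ (1 - q))))%:E
              * divergence b xmin (x k0))%E &
          growth_condition b C -> weak_to_weakstar_seq_continuous b ->
            exists2 z, minimizers f g C z & weak_cvg x z])) /\
  (uniformly_convex_on b (zone b) -> growth_condition b C).
Proof.
have [min_ex min_zone] := A1.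
(* the claims for a given rule are instances of this one, the first with [alpha = 1] *)
have algorithm rule xmin q alpha : minimizers f g C xmin -> 0 < q < 1 -> 0 < alpha ->
    exists (x : nat -> X) (k0 : nat),
      [/\ constructible b f g C rule x,
          converges_at_rate f g C q x,
          (0 < k0)%N /\ forall k, (k0 <= k)%N ->
            (objective f g C (x k.+1) - objective f g C xmin <=
              (k.+1%:R / (k.+1%:R - k0%:R)
                 * (alpha / (mu * k.+1%:R `^ (1 - q))))%:E
              * divergence b xmin (x k0))%E &
          weak_to_weakstar_seq_continuous b ->
            exists2 z, minimizers f g C z & weak_cvg x z].
  move=> xminP q01 alpha0; have /andP[q0 q1] := q01.
  have /(minimizersP f g_ninfty g_proper)[Cxmin gxmin _] := xminP.
  have [T [k0 [[TA2 TA3 TA4] [k00 T1 T_growth T_start]]]] :=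
    telescope_exists b_bregman C_dom C_closed C_convex f_gateaux g_ninfty g_proper g_convex
      g_lsc b_strong A2 A3 A4 Cxmin alpha0 q0.
  have [L [x [x_run [Tx1 LP xS test Lgrow]]]] : exists L x,
      run b f g C rule T (fun=> mu) x /\ controlled_run b f g C mu T alpha q k0 L x.
    case: rule.
      have [L [x [h1 h2]]] := lipschitz_controlled_run b_bregman C_dom f_gateaux g_ninfty
        g_convex g_lsc b_strong TA2 TA3 TA4 alpha0 q0 k00 T_growth.
      by exists L, x; split => //; exists L.
    have [eta [L [x [h1 h2]]]] := backtracking_controlled_run b_bregman C_dom f_gateaux g_ninfty
        g_convex g_lsc b_strong TA2 TA3 TA4 alpha0 q0 T_growth T_start.
    by exists L, x; split => //; exists eta, L.
  have L_pos k : (0 < k)%N -> 0 < L k by case/LP.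
  have L_incr k : (0 < k)%N -> L k <= L k.+1 by case/LP.
  have T_incr k : (0 < k)%N -> T k `<=` T k.+1.
    by move=> k_gt0; apply: (telescope_subset TA2 k_gt0).
  have TC k : (0 < k)%N -> T k `<=` C by move=> k_gt0; have [/(_ k k_gt0)[_ []]] := TA2.
  have T_cover : \bigcup_(k in [set k | (0 < k)%N]) T k = C by have [_ []] := TA2.
  have xT := run_in_telescope TA2 TA4 Tx1 L_pos xS.
  have gx := run_finite b_bregman C_dom f_gateaux g_ninfty g_convex g_lsc b_strong TA2 TA4
    Tx1 L_pos xS.
  have dec k z (k_gt0 : (0 < k)%N) := run_decrease b_bregman C_dom f_convex f_gateaux g_ninfty
    g_convex g_lsc b_strong TA2 TA4 Tx1 L_pos xS k_gt0 (test k k_gt0) (z := z).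
  have Tk0 : T k0.+1 xmin by exact: (telescope_subset TA2 (ltn0Sn 0) _ T1).
  have rate := objective_rate b_bregman C_dom g_ninfty g_proper b_strong T_incr TC xT gx L_pos
    L_incr dec xminP k00 Tk0 Lgrow.
  have conv := objective_converges b_bregman C_dom g_ninfty g_proper b_strong T_incr TC xT gx
    L_pos L_incr dec xminP k00 Tk0 alpha0 q01 Lgrow.
  exists x, k0; split => //.
  - by exists T, (fun=> mu).
  - split => // k k0k; have k_gt0 : (0 < k)%N by exact: leq_trans k0k.
    rewrite (objectiveE f g_ninfty (TC _ (ltn0Sn k) _ (xT _ (ltn0Sn k)).1) (gx k k_gt0)).
    rewrite (objectiveE f g_ninfty Cxmin gxmin).
    rewrite (divergenceE b_bregman (C_dom _ Cxmin) (xT _ k00).2) -EFinB -EFinM lee_fin.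
    exact: rate.
  - move=> w2w; exact: (weakly_converges b_bregman C_dom C_closed C_convex f_convex f_lsc g_ninfty
      g_proper g_convex g_lsc b_strong T_incr TC T_cover xT gx L_pos dec
      X_reflexive min_ex min_zone conv w2w).
split; last by move=> [psi b_unif]; exact: (uniformly_convex_growth b_bregman b_unif C_dom).
move=> rule; split.
  move=> q q01; have [xmin xminP] := min_ex.
  have [x [k0 [h1 h2 _ h4]]] := algorithm rule xmin q 1 xminP q01 ltr01.
  by exists x; split => // _; exact: h4.
move=> xmin q y0 alpha xminP q01 _ alphaP.
have alpha0 : 0 < alpha by apply: le_lt_trans alphaP; exact: operator_norm_ge0.
have [x [k0 [h1 h2 h3 h4]]] := algorithm rule xmin q alpha xminP q01 alpha0.
by exists x, k0; split => // _; exact: h4.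
Qed.
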